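(* Let $F$ be a graph with $\delta(F)\geqslant 1$ that is a complete graph, or a complete bipartite graph, or a connected graph with minimum degree $1$ or $2$. Then there exists an $\varepsilon(F)>0$ such that, for any $p=p(n)$ with $p\geqslant n^{-\varepsilon(F)}\log n$, $\mathrm{wsat}(\mathbb{G}(n,p),F)=\mathrm{wsat}(n,F)$ with high probability.
   Context: All graphs are finite, undirected, without loops or multiple edges. $\delta(F)$ is the minimum degree of $F$. For graphs $G$ and $F$, a graph $H$ is weakly $(G,F)$-saturated if $H$ is a spanning subgraph of $G$ which has no copy of $F$ as a (not necessarily induced) subgraph and there is an ordering $e_1,e_2,\dots$ of the edges in $E(G)\setminus E(H)$ such that for each $i$ the spanning subgraph of $G$ with edge set $E(H)\cup\{e_1,\dots,e_i\}$ has a copy of $F$ containing $e_i$. The weak saturation number $\mathrm{wsat}(G,F)$ is the minimum number of edges in a weakly $(G,F)$-saturated graph, and $\mathrm{wsat}(n,F)=\mathrm{wsat}(K_n,F)$, where $K_n$ is the complete graph on $n$ vertices. $\mathbb{G}(n,p)$ is the Erdős–Rényi random graph on a fixed set of $n$ vertices, where every two distinct vertices are adjacent independently with probability $p$; here $p=p(n)\in[0,1]$ may depend on $n$, and lower bounds on $p$ are understood for sufficiently large $n$. ''With high probability'' means with probability tending to $1$ as $n\to\infty$. The graph $F$ is fixed (independent of $n$). *)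

(* Defs.v *)
From mathcomp Require Import all_boot all_order all_algebra.
From mathcomp Require Import reals.
Set Implicit Arguments.
Unset Strict Implicit.
Unset Printing Implicit Defensive.

(* A simple graph with vertex set V is represented by its edge set, a set of
   two-element subsets of V.  Two such graphs have the same vertex set, so H is
   a spanning subgraph of G exactly when H \subset G. *)

Definition complete_graph (V : finType) : {set {set V}} :=
  [set e : {set V} | #|e| == 2].

Definition is_graph (V : finType) (G : {set {set V}}) : bool :=
  G \subset complete_graph V.

Definition adj (V : finType) (G : {set {set V}}) : rel V :=
  fun u v => [set u; v] \in G.

Definition degree (V : finType) (G : {set {set V}}) (v : V) : nat :=
  #|[set e in G | v \in e]|.

(* Degrees in a simple graph are smaller than #|V|, so the neutral element #|V|
   is irrelevant when V is nonempty; when V is empty the value is 0. *)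
Definition min_degree (V : finType) (G : {set {set V}}) : nat :=
  \big[minn/#|V|]_(v : V) degree G v.

Definition is_complete (V : finType) (G : {set {set V}}) : Prop :=
  G = complete_graph V.

Definition is_complete_bipartite (V : finType) (G : {set {set V}}) : Prop :=
  exists A : {set V},
    [/\ A != set0, ~: A != set0 & G = [set [set u; v] | u in A, v in ~: A]].

Definition is_connected (V : finType) (G : {set {set V}}) : Prop :=
  forall u v : V, connect (adj G) u v.

Definition image_graph (T V : finType) (f : T -> V) (F : {set {set T}}) :
    {set {set V}} :=
  [set f @: (e : {set T}) | e in F].

Definition has_copy (T V : finType) (F : {set {set T}}) (H : {set {set V}}) :
    bool :=
  [exists f : {ffun T -> V}, injectiveb f && (image_graph f F \subset H)].

Definition has_copy_through (T V : finType) (F : {set {set T}})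
    (H : {set {set V}}) (e : {set V}) : bool :=
  [exists f : {ffun T -> V},
    [&& injectiveb f, image_graph f F \subset H & e \in image_graph f F]].

Definition weakly_saturated (T V : finType) (F : {set {set T}})
    (G H : {set {set V}}) : bool :=
  [&& H \subset G, ~~ has_copy F H &
    [exists s : #|G :\: H|.-tuple {set V},
      perm_eq s (enum (G :\: H)) &&
      [forall i : 'I_#|G :\: H|,
        has_copy_through F (H :|: [set e in take i.+1 s]) (tnth s i)]]].

(* The default G of the arg min is only returned when there is no weakly
   saturated H; weakly_saturated_exists excludes this as soon as F has an
   edge. *)
Definition wsat (T V : finType) (F : {set {set T}}) (G : {set {set V}}) : nat :=
  #|[arg min_(H < G | weakly_saturated F G H) #|H|]|.

Lemma weakly_saturated_exists (T V : finType) (F : {set {set T}})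
    (G : {set {set V}}) :
  F != set0 -> exists H, weakly_saturated F G H.
Proof.
move=> F0.
pose P (H : {set {set V}}) := (H \subset G) && ~~ has_copy F H.
have P0 : P set0.
  rewrite /P sub0set; apply/existsPn => f; rewrite negb_and; apply/orP; right.
  by rewrite subset0 imset_eq0.
have [H /maxsetP[/andP[HG HF] Hmax] _] := maxset_exists P0.
exists H; rewrite /weakly_saturated HG HF /=.
have szs : size (enum (G :\: H)) == #|G :\: H| by rewrite -cardE.
apply/existsP; exists (Tuple szs); rewrite perm_refl /=.
apply/forallP => i; set s := Tuple szs; set e := tnth s i.
have eGH : e \in G :\: H by rewrite -mem_enum; exact: (mem_tnth i s).
have /setDP[eG eH] := eGH.
have /existsP[f /andP[finj fsub]] : has_copy F (e |: H).
  apply: contraT => nc; move: eH.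
  have /Hmax E : P (e |: H) by rewrite /P nc subUset sub1set eG HG.
  by rewrite -(E (subsetUr _ _)) setU11.
apply/existsP; exists f; rewrite finj /=.
have ein : e \in take i.+1 s.
  rewrite /e (tnth_nth set0) -(nth_take _ (ltnSn i)) mem_nth //.
  by rewrite size_take size_tuple; case: ifP.
apply/andP; split.
  apply: (subset_trans fsub); rewrite subUset subsetUl andbT sub1set.
  by rewrite !inE ein orbT.
apply: contraR HF => enf.
apply/existsP; exists f; rewrite finj /=.
apply/subsetP => x xf; move/subsetP: fsub => /(_ x xf).
by rewrite !inE => /orP[/eqP xe|//]; rewrite -xe xf in enf.
Qed.

Import GRing.Theory.
Local Open Scope ring_scope.

(* The law of the random graph G(n, p) on 'I_n: each of the possible edges is
   present independently with probability p. *)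
Definition gnp_weight (R : realType) (n : nat) (p : R)
    (G : {set {set 'I_n}}) : R :=
  \prod_(e in complete_graph 'I_n) (if e \in G then p else 1 - p).

Definition gnp_prob (R : realType) (n : nat) (p : R)
    (Q : pred {set {set 'I_n}}) : R :=
  \sum_(G : {set {set 'I_n}} | is_graph G && Q G) gnp_weight p G.

Lemma gnp_probT (R : realType) (n : nat) (p : R) :
  gnp_prob p (@predT {set {set 'I_n}}) = 1.
Proof.
pose K := complete_graph 'I_n.
pose a (e : {set 'I_n}) : R := if e \in K then p else 0.
pose b (e : {set 'I_n}) : R := if e \in K then 1 - p else 1.
have ab : \prod_e (a e + b e) = 1.
  apply: big1 => e _; rewrite /a /b; case: ifP => _; last by rewrite add0r.
  by rewrite addrC subrK.
rewrite -ab bigA_distr /= [RHS](bigID (@is_graph _)) /= [X in _ + X]big1.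
  rewrite addr0; apply: eq_big => [G|G /andP[/subsetP GK _]]; first by rewrite andbT.
  rewrite /gnp_weight big_mkcond /=; apply: eq_bigr => e _; rewrite /a /b -/K.
  by case: (boolP (e \in G)) => [/GK ->|_].
move=> G /subsetPn[e eG eK].
by rewrite (bigD1 e) //= eG /a (negPf eK) mul0r.
Qed.

(* Main.v *)
From HB Require Import structures.
From mathcomp Require Import all_classical all_reals all_analysis.
From mathcomp Require Import all_boot all_order all_algebra.
From mathcomp Require Import zify ring lra.
Require Import Defs.
Set Implicit Arguments.
Unset Strict Implicit.
Unset Printing Implicit Defensive.
Import Order.TTheory GRing.Theory Num.Theory.
Import numFieldNormedType.Exports.

(** Let [delta] be the minimum degree of [F].  The only random input is that, for a
constant [k] depending on [F], with high probability every set of at most [k]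
vertices of the random graph has a common neighbour ([gnp_extendable_cvg]).  For
a graph [G] on [n] vertices with this property the equality of the two weak
saturation numbers is deterministic ([wsat_extendable]).

One inequality is easy: [G] percolates to the complete graph, because the ends of
a missing edge have a large common clique of neighbours, so a weakly saturated
subgraph of [G] also percolates in the complete graph ([wsat_complete_le]).

For the other one, a clique of fixed size [n0] in [G] carrying an optimal weakly
saturated graph is extended to all of [G] at the cost of [delta - 1] edges per
new vertex ([wsat_extendable_le]), whence
[wsat F G <= wsat F K_n0 + (delta - 1) * (n - n0)].
Once [wsat F K_n - (delta - 1) * n] is bounded below ([wsat_linear_lower_bound]),
[n0] can be chosen to minimise this difference, and then the right-hand side above
is at most [wsat F K_n], whatever the exact value of the latter.

The linear lower bound is where the class of [F] enters.  For complete and complete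
bipartite graphs, represent edges by vectors such that in every copy of [F] each
edge is in the span of the others; then a percolating graph spans everything, and
it has at least as many edges as the rank ([stress_rank]).  For connected graphs
with minimum degree 2 a percolating graph is connected if [F] is a cycle
([wsat_ge_cycle]) and has no tree component otherwise ([wsat_ge_noncycle]). *)

(** * Weak saturation as percolation *)

(** The closure of [H] under adding edges of [G] that complete a copy of [F].
Unlike the orderings in [weakly_saturated], it is monotone in [G] and [H] by
construction and needs no bookkeeping of the order. *)
Inductive active (T V : finType) (F : {set {set T}}) (G H : {set {set V}}) :
    {set V} -> Prop :=
| active_base e : e \in H -> active F G H e
| active_step (f : T -> V) e0 : injective f -> e0 \in F -> f @: (e0 : {set T}) \in G ->
    (forall e : {set T}, e \in F -> f @: e != f @: e0 -> active F G H (f @: e)) ->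
    active F G H (f @: e0).

Definition percolates (T V : finType) (F : {set {set T}}) (G H : {set {set V}}) :=
  H \subset G /\ forall e, e \in G -> active F G H e.

Lemma active_trans (T V : finType) (F : {set {set T}}) (G G' H H' : {set {set V}}) e :
  G \subset G' -> (forall e, e \in H -> active F G' H' e) ->
  active F G H e -> active F G' H' e.
Proof.
move=> /subsetP GG' HH'; elim=> [{}e /HH' //|f e0 finj e0F eG _ IH].
by apply: active_step => //; exact: GG'.
Qed.

Lemma active_sub (T V : finType) (F : {set {set T}}) (G H : {set {set V}}) e :
  H \subset G -> active F G H e -> e \in G.
Proof. by move=> /subsetP HG; elim=> [{}e /HG|]. Qed.

(** By induction along the ordering, every edge of a prefix is active. *)
Lemma weakly_saturated_percolates (T V : finType) (F : {set {set T}})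
    (G H : {set {set V}}) : weakly_saturated F G H -> percolates F G H.
Proof.
case/and3P=> HG _ /existsP[s /andP[sE /forallP sP]]; split=> // e eG.
have [eH|eH] := boolP (e \in H); first exact: active_base.
suff act m : (m <= #|G :\: H|)%N -> forall e, e \in take m s -> active F G H e.
  apply: (act _ (leqnn _)); rewrite take_oversize ?size_tuple //.
  by rewrite (perm_mem sE) mem_enum inE eH eG.
elim: m => [_|m IH m_lt] e'; first by rewrite take0.
have sz : (m < size s)%N by rewrite size_tuple.
rewrite (take_nth set0) // mem_rcons inE => /orP[/eqP->|]; last exact: IH (ltnW _) _.
have /existsP[f /and3P[/injectiveP finj /subsetP fsub /imsetP[e0 e0F e0E]]] :=
  sP (Ordinal m_lt).
have eE : nth set0 s m = f @: e0 by rewrite -e0E (tnth_nth set0).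
rewrite eE; apply: active_step => //.
  have := mem_nth set0 sz.
  by rewrite eE (perm_mem sE) mem_enum inE => /andP[].
move=> e1 e1F e1E; have := fsub (f @: e1) (imset_f _ e1F).
rewrite !inE /= (take_nth set0) // mem_rcons inE eE (negPf e1E) /=.
by case/orP=> [/active_base//|]; exact: IH (ltnW _) _.
Qed.

(** The default value of the arg min is out of play once some weakly saturated
subgraph exists, so that [wsat] is then an actual minimum. *)
Lemma wsatP (T V : finType) (F : {set {set T}}) (G H0 : {set {set V}}) :
  weakly_saturated F G H0 ->
  exists H, [/\ weakly_saturated F G H, #|H| = wsat F G &
    forall H', weakly_saturated F G H' -> (#|H| <= #|H'|)%N].
Proof.
move=> H0w; have [H HW Hmin] := @arg_minnP _ H0 (weakly_saturated F G) (fun H => #|H|) H0w.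
rewrite /wsat /arg_min /extremum; case: pickP => [H' /andP[HW' /forallP min']|none].
  by exists H'; split=> // H'' W; have /implyP := min' H''; exact.
have := none H; rewrite /= HW /=; case/negP; apply/forallP=> H'.
by apply/implyP; exact: Hmin.
Qed.

(** Being free of copies of [F] costs nothing when minimising: an edge of a copy of
[F] inside a percolating [H] is restored by the other edges of that copy, so it
can be deleted.  For an [F]-free percolating [H] an ordering of the remaining
edges is built greedily; it can only get stuck when the edges reached so far are
closed under the process, hence contain all active edges. *)
Lemma wsat_le (T V : finType) (F : {set {set T}}) (G H : {set {set V}}) :
  F != set0 -> percolates F G H -> (wsat F G <= #|H|)%N.
Proof.
move=> F0; have [m] := ubnP #|H|; elim: m H => // m IH H Hm [HG Hact].
have [/existsP[f /andP[/injectiveP finj /subsetP fsub]]|ncopy] := boolP (has_copy F H).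
  have /set0Pn[e0 e0F] := F0.
  have eH := fsub _ (imset_f (fun e : {set T} => f @: e) e0F).
  have Hc : (#|H :\ (f @: e0)| < #|H|)%N by rewrite [X in (_ < X)%N](cardsD1 (f @: e0)) eH.
  apply: leq_trans (ltnW Hc); apply: IH; first exact: leq_trans Hc Hm.
  split=> [|e eG]; first exact: subset_trans (subD1set _ _) HG.
  apply: active_trans (Hact e eG) => // {eG}e eH'.
  have [->|ne] := eqVneq e (f @: e0); last by apply: active_base; rewrite !inE ne.
  apply: active_step => // [|e1 e1F ne1]; first by apply: (subsetP HG).
  by apply: active_base; rewrite !inE ne1 fsub //; exact: imset_f.
suff W : weakly_saturated F G H by have [H' [_ <-]] := wsatP W; apply.
pose valid (s : seq {set V}) := forall i, (i < size s)%N ->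
  has_copy_through F (H :|: [set e in take i.+1 s]) (nth set0 s i).
suff [s [us sE sv]] : exists s : seq {set V}, [/\ uniq s, s =i G :\: H & valid s].
  rewrite /weakly_saturated HG ncopy /=; apply/existsP.
  have szs : size s == #|G :\: H| by rewrite -(card_uniqP us) (eq_card sE).
  exists (Tuple szs); apply/andP; split.
    by apply: uniq_perm; rewrite ?enum_uniq // => x; rewrite sE mem_enum.
  by apply/forallP=> i; rewrite (tnth_nth set0); apply: sv; rewrite (eqP szs).
suff grow s : uniq s -> {subset s <= G :\: H} -> valid s ->
    exists s, [/\ uniq s, s =i G :\: H & valid s].
  by apply: (grow [::]) => // i.
have [d] := ubnP (#|G :\: H| - size s); elim: d s => // d IHd s sd us sGH sv.
have [/forallP cl|] := boolP [forall e, (e \in G) ==>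
    has_copy_through F (e |: (H :|: [set x in s])) e ==> (e \in H :|: [set x in s])].
  exists s; split=> // e; apply/idP/idP=> [/sGH //|]; rewrite inE => /andP[eH eG].
  suff : e \in H :|: [set x in s] by rewrite !inE (negPf eH).
  elim: (Hact e eG) => [e' e'H|f e0 finj e0F fe0G _ IHe]; first by rewrite inE e'H.
  have /implyP/(_ fe0G)/implyP := cl (f @: e0); apply.
  apply/existsP; exists (finfun f); apply/and3P; split.
  - by apply/injectiveP=> x y; rewrite !ffunE => /finj.
  - apply/subsetP=> _ /imsetP[e1 e1F ->]; rewrite inE.
    have E e2 : finfun f @: (e2 : {set T}) = f @: e2.
      by apply: eq_imset => x; rewrite ffunE.
    rewrite E inE; have [//|/= ne] := eqVneq (f @: e1) (f @: e0).
    exact: IHe.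
  - apply/imsetP; exists e0 => //.
    by apply: eq_imset => x; rewrite ffunE.
case/forallPn=> e; rewrite !negb_imply => /and3P[eG ecopy].
rewrite !inE negb_or => /andP[eH es].
have sizes : (size s < #|G :\: H|)%N.
  rewrite -(card_uniqP us); apply: proper_card; apply/properP; split.
    by apply/subsetP.
  by exists e => //; rewrite inE eH eG.
apply: (IHd (rcons s e)).
- by rewrite size_rcons subnS prednK ?subn_gt0 // -ltnS.
- by rewrite rcons_uniq es us.
- by move=> x; rewrite mem_rcons inE => /orP[/eqP->|/sGH //]; rewrite inE eH eG.
move=> i; rewrite size_rcons ltnS leq_eqVlt => /orP[/eqP->|lt_i].
  rewrite nth_rcons ltnn eqxx take_oversize ?size_rcons //.
  have -> // : H :|: [set x in rcons s e] = e |: (H :|: [set x in s]).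
  by apply/setP=> x; rewrite !inE mem_rcons inE orbCA.
by rewrite nth_rcons lt_i -cats1 takel_cat //; exact: sv.
Qed.

Lemma wsat_attained (T V : finType) (F : {set {set T}}) (G : {set {set V}}) :
  F != set0 -> exists2 H, percolates F G H & #|H| = wsat F G.
Proof.
move=> F0; have [H0 /wsatP[H [HW HE _]]] := weakly_saturated_exists G F0.
by exists H => //; exact: weakly_saturated_percolates.
Qed.

(** * Activating edges next to a clique *)

Lemma exists_subset_card (V : finType) (A : {set V}) m : (m <= #|A|)%N ->
  exists2 B : {set V}, B \subset A & #|B| = m.
Proof.
move=> mA; exists [set x in take m (enum A)].
  by apply/subsetP=> x; rewrite inE => /mem_take; rewrite mem_enum.
have /card_uniqP u : uniq (take m (enum A)) by rewrite take_uniq ?enum_uniq.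
by rewrite cardsE u size_take_min -cardE (minn_idPl mA).
Qed.

Lemma edge_ends (V : finType) (G : {set {set V}}) (e : {set V}) :
  is_graph G -> e \in G -> exists x y, x != y /\ e = [set x; y].
Proof.
by move=> /subsetP sG /sG; rewrite inE => /cards2P.
Qed.

Lemma adj_neq (V : finType) (G : {set {set V}}) x y : is_graph G -> adj G x y -> x != y.
Proof.
by move=> /subsetP sG /sG; rewrite inE cards2; case: (x != y).
Qed.

Lemma adjxx (V : finType) (G : {set {set V}}) x : is_graph G -> adj G x x = false.
Proof. by move=> gG; apply/negP=> /(adj_neq gG); rewrite eqxx. Qed.

Lemma adjC (V : finType) (G : {set {set V}}) : symmetric (adj G).
Proof. by move=> x y; rewrite /adj setUC. Qed.

Lemma degree_card_adj (T : finType) (F : {set {set T}}) a :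
  is_graph F -> degree F a = #|[set b | adj F a b]|.
Proof.
move=> gF; rewrite /degree -(card_in_imset (f := fun b => [set a; b])).
  congr #|pred_of_set _|; apply/setP=> e; rewrite inE.
  apply/andP/imsetP=> [[eF ae]|[b]]; last first.
    by rewrite inE /adj => ab ->; rewrite !inE eqxx.
  have [x [y [xy eE]]] := edge_ends gF eF.
  move: ae eF; rewrite eE !inE => /orP[]/eqP->.
    by exists y; rewrite ?inE.
  by rewrite setUC; exists x; rewrite ?inE.
move=> b c; rewrite !inE => ab ac /setP E.
have := E b; rewrite !inE eqxx orbT => /esym/orP[]/eqP // ba.
by have := adj_neq gF ab; rewrite ba eqxx.
Qed.

(** Injections with prescribed values on a list: enumerate the rest of [T] after
[xs] and send the i-th vertex to the i-th entry of [ys]. *)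
Lemma embedding_along (T V : finType) (xs : seq T) (ys : seq V) (x0 : T) (y0 : V) :
  uniq xs -> uniq ys -> (#|T| <= size ys)%N ->
  exists f : T -> V, [/\ injective f, forall x, f x \in ys &
    forall i, (i < size xs)%N -> f (nth x0 xs i) = nth y0 ys i].
Proof.
move=> uxs uys szys; pose zs := xs ++ [seq x <- enum T | x \notin xs].
have uzs : uniq zs.
  rewrite cat_uniq uxs filter_uniq ?enum_uniq // andbT.
  by apply/hasPn=> x; rewrite mem_filter => /andP[].
have zsT x : x \in zs.
  by rewrite mem_cat mem_filter mem_enum andbT orbN.
have szs : size zs = #|T|.
  by rewrite -(card_uniqP uzs); apply: eq_card => x; rewrite zsT.
have idx x : (index x zs < size ys)%N.
  by apply: leq_trans szys; rewrite -szs index_mem.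
exists (fun x => nth y0 ys (index x zs)); split.
- move=> x y /eqP; rewrite nth_uniq // => /eqP E.
  by rewrite -(nth_index x (zsT x)) E nth_index.
- by move=> x; rewrite mem_nth.
move=> i isz; congr nth; rewrite -[nth x0 xs i](_ : nth x0 zs i = _).
  by rewrite index_uniq // size_cat ltn_addr.
by rewrite nth_cat isz.
Qed.

Section Completion.
Variables (T V : finType) (F : {set {set T}}) (G H : {set {set V}}).
Hypotheses (F_graph : is_graph F) (G_graph : is_graph G) (HG : H \subset G).

Let act x y := active F G H [set x; y].

Let actC x y : act x y -> act y x. Proof. by rewrite /act setUC. Qed.

Let act_adj x y : act x y -> adj G x y. Proof. exact: active_sub. Qed.

Let act_neq x y : act x y -> x != y.
Proof. by move/act_adj; exact: adj_neq. Qed.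

(** Put an edge of [F] on [x], [y] and all other vertices of [F] into the clique
[M]; every edge of this copy but [x y] is already active. *)
Lemma active_in_clique (M : {set V}) x y :
  F != set0 -> (#|T| <= #|M|)%N -> {in M &, forall u v, u != v -> act u v} ->
  {in M, forall z, act x z /\ act y z} -> adj G x y -> act x y.
Proof.
case/set0Pn=> e0 e0F TM MM xyM xyG.
have [a [b [ab e0E]]] := edge_ends F_graph e0F.
have xM : x \notin M by apply/negP => /xyM[/act_neq]; rewrite eqxx.
have yM : y \notin M by apply/negP => /xyM[_ /act_neq]; rewrite eqxx.
have xy := adj_neq G_graph xyG.
have [|||f [finj fys fxs]] := @embedding_along T V [:: a; b] (x :: y :: enum M) a x.
- by rewrite /= !inE ab.
- by rewrite /= !inE mem_enum negb_or xy xM mem_enum yM enum_uniq.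
- by rewrite /= -cardE; apply: leq_trans TM _; rewrite -addn2 leq_addr.
have /= fa : f a = x := fxs 0 isT.
have /= fb : f b = y := fxs 1 isT.
have E : f @: e0 = [set x; y] by rewrite e0E imsetU1 imset_set1 fa fb.
rewrite /act -E; apply: active_step => //; first by rewrite E.
move=> e eF; rewrite E; have [c [d [cd ->]]] := edge_ends F_graph eF.
rewrite imsetU1 imset_set1.
have : f c != f d by rewrite (inj_eq finj).
have := fys c; have := fys d; rewrite !inE !mem_enum.
case/or3P=> [/eqP->|/eqP->|dM]; case/or3P=> [/eqP->|/eqP->|cM]; rewrite ?eqxx //.
- by rewrite setUC eqxx.
- by move=> _ _; case: (xyM _ cM) => /actC.
- by move=> _ _; case: (xyM _ cM) => _ /actC.
- by move=> _ _; case: (xyM _ dM).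
- by move=> _ _; case: (xyM _ dM).
- by move=> ne _; apply: MM.
Qed.

(** Place [a] at [x], one neighbour of [a] at [z], its other neighbours inside [D]
and the rest of [F] inside the clique [M].  So [degree F a - 1] active edges from
[x] into an active clique are enough to activate all edges from [x] to it. *)
Lemma active_pendant (M D : {set V}) a x z :
  (0 < degree F a)%N -> ((degree F a).-1 <= #|D|)%N -> (#|T| <= #|M|)%N ->
  {in M &, forall u v, u != v -> act u v} -> D \subset M -> x \notin M ->
  {in D, forall d, act x d} -> z \in M -> adj G x z -> act x z.
Proof.
move=> a_gt0 aD TM MM /subsetP DM xM xD zM xz.
have [/xD//|zD] := boolP (z \in D).
rewrite degree_card_adj // in a_gt0 aD.
have /card_gt0P[b ab] := a_gt0; rewrite (cardsD1 b) ab /= in aD.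
set N := _ :\ b in aD.
have NE c : c \in N = (c != b) && adj F a c by rewrite !inE.
rewrite inE in ab.
(* the list of images starts with x, z and D, so that the vertices listed right
   after b, namely the remaining neighbours of a, land in D *)
have ys_u : uniq (x :: z :: enum D ++ enum (M :\: D :\ z)).
  rewrite /= !inE negb_or !mem_cat !mem_enum !inE eqxx (negPf zD) (negPf xM).
  rewrite !andbF !orbF cat_uniq !enum_uniq andbT /=.
  have -> : x != z by apply: contraNneq xM => ->.
  have -> : x \notin D by apply: contra xM => /DM.
  by apply/hasPn=> u; rewrite !mem_enum !inE => /and3P[].
have xs_u : uniq (a :: b :: enum N).
  rewrite /= inE negb_or !mem_enum !inE eqxx enum_uniq (adj_neq F_graph ab) /= andbT.
  by rewrite adjxx.
have [|f [finj fys fxs]] := @embedding_along T V _ _ a x xs_u ys_u.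
  apply: leq_trans TM _; rewrite /= size_cat -!cardE.
  rewrite (cardsD1 z M) zM -(cardsID D (M :\ z)) setIC.
  have -> : D :&: (M :\ z) = D.
    apply/setIidPl/subsetP=> d dD; rewrite !inE DM // andbT.
    by apply: contraNneq zD => <-.
  have -> : M :\ z :\: D = M :\: D :\ z by rewrite !setDDl setUC.
  by rewrite add1n ltnW.
have fa : f a = x := fxs 0 isT.
have fb : f b = z := fxs 1 isT.
have fN c : c \in N -> f c \in D.
  move=> cN; have ic : (index c (enum N) < #|N|)%N by rewrite cardE index_mem mem_enum.
  have := fxs (index c (enum N)).+2.
  rewrite /= !ltnS -cardE => /(_ ic).
  rewrite nth_index ?mem_enum // nth_cat -cardE (leq_trans ic aD) => ->.
  by rewrite -mem_enum mem_nth // -cardE (leq_trans ic aD).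
have fM c : c != a -> f c \in M.
  move=> ca; have := fys c; rewrite inE -fa (inj_eq finj) (negPf ca) /=.
  rewrite inE mem_cat !mem_enum !inE => /or3P[/eqP->//|/DM//|/and3P[]//].
have E : f @: [set a; b] = [set x; z] by rewrite imsetU1 imset_set1 fa fb.
rewrite /act -E; apply: active_step => //; first by rewrite E.
move=> e eF; rewrite E; have [c [d [cd eE]]] := edge_ends F_graph eF.
wlog da : c d cd eE / d != a.
  move=> W; have [da|] := eqVneq d a; last exact: (W c d).
  by apply: (W d c); [rewrite eq_sym | rewrite setUC | rewrite -da].
rewrite eE imsetU1 imset_set1; have [ca|ca] := eqVneq c a.
  rewrite ca fa; have [->|db] := eqVneq d b; first by rewrite fb eqxx.
  move=> _; apply/xD/fN; rewrite NE db /=.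
  by rewrite /adj -ca -eE.
by move=> _; apply: MM; rewrite ?fM // (inj_eq finj).
Qed.
End Completion.

(** * Saturating graphs with common neighbours *)

(** Every set of at most [k] vertices has a common neighbour.  This is the only
property of the random graph that the argument uses. *)
Definition extendable (V : finType) (k : nat) (G : {set {set V}}) : bool :=
  [forall S : {set V}, (#|S| <= k)%N ==> [exists z, [forall s in S, adj G z s]]].

Lemma extendableP (V : finType) (k : nat) (G : {set {set V}}) :
  reflect (forall S : {set V}, (#|S| <= k)%N -> exists z, {in S, forall s, adj G z s})
          (extendable k G).
Proof.
apply: (iffP forallP) => [ext S Sk|ext S].
  have /implyP/(_ Sk)/existsP[z /forall_inP zS] := ext S.
  by exists z.
apply/implyP=> /ext[z zS]; apply/existsP; exists z; exact/forall_inP.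
Qed.

(** Add common neighbours of the set built so far, one at a time. *)
Lemma extendable_clique (V : finType) k (G : {set {set V}}) (S : {set V}) m :
  is_graph G -> extendable k G -> (#|S| + m <= k)%N ->
  exists M : {set V}, [/\ #|M| = m, {in M &, forall u v, u != v -> adj G u v} &
    {in M & S, forall u s, adj G u s}].
Proof.
move=> gG /extendableP ext; elim: m => [_|m IH Sm].
  by exists set0; rewrite cards0; split=> // x y; rewrite inE.
have [|M [Mm MM MS]] := IH; first by apply: leq_trans Sm; rewrite addnS.
have [|z zSM] := ext (S :|: M).
  apply: leq_trans (leq_card_setU _ _) _; rewrite Mm.
  by apply: leq_trans Sm; rewrite addnS.
have zM u : u \in M -> adj G z u by move=> uM; rewrite zSM // inE uM orbT.
exists (z |: M); split.
- by rewrite cardsU1 Mm; case: (boolP (z \in M)) => [/zM|//]; rewrite adjxx.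
- move=> u v; rewrite !inE => /orP[/eqP->|uM] /orP[/eqP->|vM]; rewrite ?eqxx //.
  + by rewrite zM.
  + by rewrite adjC zM.
  + exact: MM.
- move=> u s; rewrite !inE => /orP[/eqP->|uM] sS; last exact: MS.
  by rewrite zSM // inE sS.
Qed.

(** The ends of a missing edge have a common clique of [#|T|] neighbours. *)
Lemma extendable_percolates (T V : finType) (F : {set {set T}}) k (G : {set {set V}}) :
  is_graph F -> F != set0 -> is_graph G -> (#|T| + 2 <= k)%N -> extendable k G ->
  percolates F (complete_graph V) G.
Proof.
move=> gF F0 gG Tk ext; split=> // e; rewrite inE => /cards2P[x [y [xy ->]]].
have [|M [MT MM MS]] := @extendable_clique _ k G [set x; y] #|T| gG ext.
  by rewrite cards2 xy addnC.
apply: (@active_in_clique _ _ _ _ _ gF _ gG M) => //; rewrite ?MT //.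
- exact: subxx.
- by move=> u v uM vM uv; apply: active_base; apply: MM.
- move=> z zM; split; apply: active_base.
    by rewrite -/(adj G x z) adjC MS // !inE eqxx.
  by rewrite -/(adj G y z) adjC MS // !inE eqxx orbT.
- by rewrite /adj inE cards2 xy.
Qed.

Lemma percolates_trans (T V : finType) (F : {set {set T}}) (G1 G2 G3 : {set {set V}}) :
  percolates F G3 G2 -> percolates F G2 G1 -> percolates F G3 G1.
Proof.
move=> [s32 act32] [s21 act21]; split; first exact: subset_trans s21 s32.
move=> e /act32; apply: active_trans => // {}e /act21.
by apply: active_trans => // {}e; exact: active_base.
Qed.

(** A graph that percolates in [G] also percolates in the complete graph, through
[G] itself. *)
Lemma wsat_complete_le (T V : finType) (F : {set {set T}}) k (G : {set {set V}}) :
  is_graph F -> F != set0 -> is_graph G -> (#|T| + 2 <= k)%N -> extendable k G ->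
  (wsat F (complete_graph V) <= wsat F G)%N.
Proof.
move=> gF F0 gG Tk ext; have [H HG <-] := wsat_attained G F0.
by apply: wsat_le => //; apply: percolates_trans HG; apply: (extendable_percolates (k := k)).
Qed.

Lemma active_image (T V W : finType) (F : {set {set T}}) (G H : {set {set V}})
    (G' H' : {set {set W}}) (g : V -> W) :
  injective g -> (forall e : {set V}, e \in G -> g @: e \in G') ->
  (forall e : {set V}, e \in H -> g @: e \in H') ->
  forall e : {set V}, active F G H e -> active F G' H' (g @: e).
Proof.
move=> ginj GG' HH' e; elim=> [{}e /HH'|f e0 finj e0F eG act IH]; first exact: active_base.
have E (e1 : {set T}) : g @: (f @: e1) = (g \o f) @: e1 by rewrite imset_comp.
rewrite E; apply: active_step => //.
- exact: inj_comp.
- by rewrite -E; apply: GG'.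
move=> e1 e1F; rewrite -!E => ne; apply: IH => //.
by apply: contraNneq ne => ->.
Qed.

(** The construction behind the upper bound.  Take a clique [Q] of size [n0] with an
optimal weakly saturated graph inside it, and for every other vertex select
[degree F a - 1] edges to a clique [M x] which is active before [x] is treated:
[M x = Q] when [x] lies in the set [A] of common neighbours of [Q], and otherwise
[M x] is a clique inside [A].  Activation then spreads from [Q] to [A], from [A]
to the remaining vertices, and finally to the edges between the latter. *)
Lemma wsat_extendable_le (T V : finType) (F : {set {set T}}) (a : T) (G : {set {set V}}) n0 k :
  is_graph F -> (0 < degree F a)%N -> is_graph G -> (#|T| <= n0)%N ->
  (n0 + #|T| + #|T| + 2 <= k)%N -> extendable k G ->
  (wsat F G <= wsat F (complete_graph 'I_n0) + (degree F a).-1 * (#|V| - n0))%N.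
Proof.
move=> gF a0 gG Tn0 n0k ext; set d := (degree F a).-1.
have F0 : F != set0.
  by apply/eqP=> F0; move: a0; rewrite /degree F0; under eq_finset do rewrite inE; rewrite cards0.
have dT : (d <= #|T|)%N.
  by apply: leq_trans (leq_pred _) _; rewrite degree_card_adj // max_card.
have [|Q [Qn0 QQ _]] := @extendable_clique _ k G set0 n0 gG ext.
  by rewrite cards0 add0n; apply: leq_trans n0k; rewrite -!addnA leq_addr.
have [H0 [H0K H0act] H0w] := wsat_attained (complete_graph 'I_n0) F0.
pose g (i : 'I_n0) : V := enum_val (cast_ord (esym Qn0) i).
have ginj : injective g by move=> i j /enum_val_inj/cast_ord_inj.
have gQ i : g i \in Q by exact: enum_valP.
have gonto q : q \in Q -> exists i, q = g i.
  move=> qQ; exists (cast_ord Qn0 (enum_rank_in qQ q)).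
  by rewrite /g cast_ordK enum_rankK_in.
pose A := [set x | [forall q in Q, adj G x q]].
have AP x q : x \in A -> q \in Q -> adj G x q.
  by rewrite inE => /forall_inP; apply.
(* every other vertex is anchored to a clique, inside A if it is not in A *)
have anchor x : exists M : {set V}, [/\ (#|T| <= #|M|)%N,
    {in M &, forall u v, u != v -> adj G u v}, {in M, forall u, adj G x u} &
    if x \in A then M == Q else (M \subset A) && (#|M| == #|T|)].
  have [xA|xA] := boolP (x \in A).
    by exists Q; split; rewrite ?Qn0 // => q; exact: AP.
  have [|M [MT MM MS]] := @extendable_clique _ k G (x |: Q) #|T| gG ext.
    by rewrite cardsU1 Qn0; have := leq_b1 (x \notin Q); lia.
  exists M; split; rewrite ?MT //.
    by move=> u uM; rewrite adjC MS // setU11.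
  rewrite eqxx andbT.
  apply/subsetP=> u uM; rewrite inE; apply/forall_inP=> q qQ.
  by rewrite MS // inE qQ orbT.
have [M MP] := fin_all_exists anchor.
(* the selected edges at x go from x to D x *)
have chooseD x : exists D : {set V}, D \subset M x /\ #|D| = d.
  have [MT _ _ _] := MP x.
  by have [D DM Dd] := exists_subset_card (leq_trans dT MT); exists D.
have [D DP] := fin_all_exists chooseD.
pose H := image_graph g H0 :|: \bigcup_(x in ~: Q) [set [set x; y] | y in D x].
have HG : H \subset G.
  apply/subsetP=> e; rewrite inE => /orP[/imsetP[e0 e0H ->]|].
    have /(edge_ends (subxx _))[i [j [ij ->]]] := subsetP H0K _ e0H.
    by rewrite imsetU1 imset_set1; apply: (QQ (g i) (g j)); rewrite ?(inj_eq ginj).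
  case/bigcupP=> x _ /imsetP[y yD ->].
  have [_ _ xM _] := MP x; have [/subsetP DM _] := DP x.
  by apply: (xM y); apply: DM.
have Hcard : (#|H| <= wsat F (complete_graph 'I_n0) + d * (#|V| - n0))%N.
  apply: leq_trans (leq_card_setU _ _) _; apply: leq_add.
    by rewrite -H0w leq_imset_card.
  have -> : (d * (#|V| - n0) = \sum_(x in ~: Q) d)%N.
    by rewrite sum_nat_const mulnC [#|~: Q|]cardsCs setCK Qn0.
  elim/big_rec2: _ => [|x m B _ IH]; first by rewrite cards0.
  apply: leq_trans (leq_card_setU _ _) _; apply: leq_add => //.
  by apply: leq_trans (leq_imset_card _ _) _; have [_ ->] := DP x.
apply: leq_trans Hcard; apply: wsat_le => //; split=> //.
pose act x y := active F G H [set x; y].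
have actC x y : act x y -> act y x by rewrite /act setUC.
have fill := @active_in_clique T V F G H gF gG HG.
have pend := @active_pendant T V F G H gF.
(* the clique Q *)
have actQ : {in Q &, forall u v, u != v -> act u v}.
  move=> u v /gonto[i ->] /gonto[j ->] ij.
  rewrite /act (_ : [set g i; g j] = g @: [set i; j]); last by rewrite imsetU1 imset_set1.
  apply: (active_image (G := complete_graph 'I_n0) (H := H0)) => //.
  - move=> e /(edge_ends (subxx _))[i' [j' [ij' ->]]].
    by rewrite imsetU1 imset_set1; apply: (QQ (g i') (g j')); rewrite ?(inj_eq ginj).
  - by move=> e eH0; rewrite inE imset_f.
  - by apply: H0act; rewrite inE cards2 -(inj_eq ginj) ij.
(* a vertex is joined to its anchor as soon as that clique is active *)
have actM x : x \notin Q -> {in M x &, forall u v, u != v -> act u v} ->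
    {in M x, forall z, act x z}.
  move=> xQ Mact z zM; have [MT _ xM _] := MP x; have [DM Dd] := DP x.
  apply: (pend (M x) (D x) a) => //; rewrite ?Dd //.
  - by apply/negP=> /xM; rewrite adjxx.
  - move=> y yD; apply: active_base; rewrite inE; apply/orP; right.
    by apply/bigcupP; exists x; rewrite ?inE //; apply: imset_f.
  - exact: xM.
have AQ x : x \in A -> x \notin Q by move=> xA; apply/negP=> /(AP _ _ xA); rewrite adjxx.
have actAQ : {in A & Q, forall x q, act x q}.
  move=> x q xA qQ; have [_ _ _] := MP x; rewrite xA => /eqP ME.
  by apply: actM; rewrite ?ME // AQ.
have actAA : {in A &, forall x y, adj G x y -> act x y}.
  move=> x y xA yA; apply: (fill Q) => //; first by rewrite Qn0.
  by move=> q qQ; split; exact: actAQ.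
have actAC x y : x \in A -> y \in Q :|: A -> adj G x y -> act x y.
  by move=> xA; rewrite inE => /orP[yQ _|]; [exact: actAQ | exact: actAA].
have actBM x : x \notin Q :|: A -> {in M x, forall z, act x z}.
  rewrite inE negb_or => /andP[xQ xA]; apply: actM => //.
  have [_ MM _] := MP x; rewrite (negPf xA) => /andP[/subsetP MA _] u v uM vM uv.
  by apply: actAA; rewrite ?MA ?MM.
(* the vertices of a small set S have a common clique of neighbours inside A *)
have link (S : {set V}) : (#|S| <= #|T| + 2)%N ->
    exists N : {set V}, [/\ (#|T| <= #|N|)%N, N \subset A,
      {in N &, forall u v, u != v -> act u v} & {in N & S, forall u s, adj G u s}].
  move=> ST; have [|N [NT NN NS]] := @extendable_clique _ k G (S :|: Q) #|T| gG ext.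
    by have [+ _] := leq_card_setU S Q; rewrite Qn0; lia.
  have NA : N \subset A.
    apply/subsetP=> u uN; rewrite inE; apply/forall_inP=> q qQ.
    by rewrite NS // inE qQ orbT.
  exists N; rewrite NT; split=> //.
    by move=> u v uN vN uv; apply: actAA; rewrite ?(subsetP NA) ?NN.
  by move=> u s uN sS; rewrite NS // inE sS.
(* the edges from x to a clique linked to M x and y are activated first *)
have actBC x y : x \notin Q :|: A -> y \in Q :|: A -> adj G x y -> act x y.
  move=> xB yC xy; have [MT MM xM] := MP x.
  have xA : x \notin A by apply: contra xB => xA; rewrite inE xA orbT.
  rewrite (negPf xA) => /andP[/subsetP MA /eqP MT'].
  have [|N [NT /subsetP NA NN NS]] := link (M x :|: [set x; y]).
    apply: leq_trans (leq_card_setU _ _) _.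
    by rewrite MT' leq_add2l cards2; case: (x != y).
  have NSx u : u \in N -> adj G x u by move=> uN; rewrite adjC NS // !inE eqxx orbT.
  have actN z : z \in N -> act x z.
    move=> zN; apply: (fill (M x)) => //; last exact: NSx.
      by move=> u v uM vM uv; apply: actAA; rewrite ?MA ?MM.
    move=> u uM; split; first exact: actBM.
    by apply: actAA; [exact: NA | exact: MA | rewrite NS // inE uM].
  apply: (fill N) => // z zN; split; first exact: actN.
  by apply/actC/actAC; [exact: NA | | rewrite NS // !inE eqxx !orbT].
move=> e eG; have [x [y [xy eE]]] := edge_ends gG eG.
move: eG; rewrite eE -/(adj G x y) -/(act x y) => xyG.
have [xC|xB] := boolP (x \in Q :|: A); last first.
  have [yC|yB] := boolP (y \in Q :|: A); first exact: actBC.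
  have [|N [NT /subsetP NA NN NS]] := link [set x; y].
    by apply: leq_trans (leq_addl _ _); rewrite cards2; case: (x != y).
  apply: (fill N) => // z zN; split; apply: actBC => //; rewrite 1?inE ?NA ?orbT //.
    by rewrite adjC NS // !inE eqxx.
  by rewrite adjC NS // !inE eqxx orbT.
have [yC|yB] := boolP (y \in Q :|: A); last by apply/actC/actBC; rewrite // adjC.
have [xA|xA] := boolP (x \in A); first exact: actAC.
have [yA|yA] := boolP (y \in A); first by apply/actC/actAC; rewrite // adjC.
by apply: actQ => //; [move: xC | move: yC]; rewrite inE ?(negPf xA) ?(negPf yA) orbF.
Qed.

(** * Connected graphs of minimum degree two *)

Definition inside (V : finType) (H : {set {set V}}) (S : {set V}) : {set {set V}} :=
  [set e in H | e \subset S].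

Definition crossing (V : finType) (H : {set {set V}}) (S : {set V}) : {set {set V}} :=
  [set e in H | ~~ (e \subset S) && ~~ [disjoint e & S]].

Lemma crossing_adj (V : finType) (H : {set {set V}}) (S : {set V}) x y :
  x \in S -> y \notin S -> adj H x y -> [set x; y] \in crossing H S.
Proof.
move=> xS yS xy; rewrite inE -/(adj H x y) xy /=; apply/andP; split.
  by apply/subsetPn; exists y; rewrite // !inE eqxx orbT.
by apply/pred0Pn; exists x; rewrite /= !inE eqxx.
Qed.

(** Each edge inside [S] is counted twice, each crossing edge once. *)
Lemma handshake (V : finType) (H : {set {set V}}) (S : {set V}) : is_graph H ->
  (\sum_(v in S) degree H v = 2 * #|inside H S| + #|crossing H S|)%N.
Proof.
move=> gH.
have -> : (\sum_(v in S) degree H v = \sum_(e in H) #|e :&: S|)%N.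
  rewrite (eq_bigr (fun v => \sum_(e in H) (v \in e))); last first.
    by move=> v _; rewrite -big_mkcondr sum1dep_card.
  rewrite exchange_big; apply: eq_bigr => e _.
  by rewrite -big_mkcondr sum1dep_card; apply: eq_card => v; rewrite !inE andbC.
rewrite (bigID (fun e : {set V} => e \subset S)) /=; congr (_ + _)%N.
  rewrite mulnC -sum_nat_const; apply: eq_big => [e|e]; first by rewrite inE.
  case/andP=> eH /setIidPl->; have := subsetP gH _ eH; rewrite inE => /eqP //.
rewrite (bigID (fun e : {set V} => [disjoint e & S])) /= [X in (X + _)%N]big1 ?add0n.
  rewrite -sum1_card; apply: eq_big => [e|e]; first by rewrite inE -andbA.
  case/andP=> /andP[eH eS]; rewrite -setI_eq0 => eS'.
  have := subsetP gH _ eH; rewrite inE => /eqP e2.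
  apply/eqP; rewrite eqn_leq card_gt0 eS' andbT -ltnS -e2; apply: proper_card.
  rewrite properE subsetIl /=; apply: contra eS => h; apply: subset_trans h _.
  exact: subsetIr.
by move=> e /andP[_]; rewrite -setI_eq0 => /eqP->; rewrite cards0.
Qed.

(** A connected [S] is exhausted from [U] by adding neighbours one at a time, and
each new vertex brings at least one new edge.  With [U] a single vertex this is
the edge bound for connected graphs; in general it says that the part of a sparse
connected graph on [U] is again sparse. *)
Lemma inside_count (V : finType) (H : {set {set V}}) (S : {set V}) :
  (forall U : {set V}, U \subset S -> U != set0 -> U != S ->
    exists u v, [/\ u \in U, v \in S :\: U & adj H u v]) ->
  forall U : {set V}, U \subset S -> U != set0 ->
  (#|inside H U| + #|S :\: U| <= #|inside H S|)%N.
Proof.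
move=> conn U; have [m] := ubnP #|S :\: U|; elim: m U => // m IH U Um US U0.
have [->|UneS] := eqVneq U S; first by rewrite setDv cards0 addn0.
have [u [v [uU vSU uv]]] := conn U US U0 UneS.
have /setDP[vS vU] := vSU.
have E : #|S :\: U| = #|S :\: (v |: U)|.+1.
  by rewrite (cardsD1 v) vSU add1n setDDl [U :|: _]setUC.
have := IH (v |: U); rewrite -ltnS -E => /(_ Um).
rewrite subUset sub1set vS US => /(_ isT).
have vU0 : v |: U != set0 by apply/set0Pn; exists v; rewrite setU11.
move=> /(_ vU0).
apply: leq_trans; rewrite E addnS -addSn leq_add2r.
apply: proper_card; apply/properP; split.
  apply/subsetP=> e; rewrite !inE => /andP[-> eU] /=.
  by apply: subset_trans eU _; rewrite subsetUr.
exists [set u; v]; rewrite !inE -/(adj H u v) uv subUset !sub1set.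
  by rewrite !inE eqxx uU orbT.
by rewrite (negPf vU) andbF.
Qed.

(** A minimal nonempty union [S] of components with fewer edges than vertices is
connected, since otherwise one of the two parts would be a smaller such union. *)
Lemma sparse_component (V : finType) (H : {set {set V}}) : is_graph H -> (#|H| < #|V|)%N ->
  exists S : {set V}, [/\ S != set0, crossing H S = set0, (#|inside H S| < #|S|)%N &
    forall U : {set V}, U \subset S -> U != set0 -> U != S ->
    exists u v, [/\ u \in U, v \in S :\: U & adj H u v]].
Proof.
move=> gH HV.
pose P (S : {set V}) := [&& S != set0, crossing H S == set0 & (#|inside H S| < #|S|)%N].
have PT : P setT.
  apply/and3P; split.
  - by rewrite -card_gt0 cardsT; apply: leq_ltn_trans HV.
  - by apply/eqP/setP=> e; rewrite !inE subsetT andbF.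
  - rewrite cardsT; apply: leq_ltn_trans HV; apply: subset_leq_card.
    by apply/subsetP=> e; rewrite inE => /andP[].
have [S Smin _] := minset_exists PT.
have /minsetP[/and3P[S0 /eqP Sx Sc] Smin'] := Smin.
exists S; split=> // U US U0 US'.
suff /existsP[u /existsP[v /and3P[uU vU uv]]] :
    [exists u, exists v, [&& u \in U, v \in S :\: U & adj H u v]] by exists u, v.
apply: contraT => /existsPn none.
have noadj u v : u \in U -> v \in S -> v \notin U -> ~~ adj H u v.
  move=> uU vS vU; have /existsPn/(_ v) := none u.
  by rewrite inE uU vU vS.
have noadjS u v : u \in S -> v \notin S -> ~~ adj H u v.
  by move=> uS vS; apply/negP=> /(crossing_adj uS vS); rewrite Sx inE.
have stay u v : u \in U -> adj H u v -> v \in U.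
  move=> uU uv; apply: contraT => vU; have [vS|vS] := boolP (v \in S).
    by have := noadj _ _ uU vS vU; rewrite uv.
  by have := noadjS u v (subsetP US _ uU) vS; rewrite uv.
have staySU u v : u \in S :\: U -> adj H u v -> v \in S :\: U.
  move=> /setDP[uS uU] uv; rewrite inE; apply/andP; split.
    by apply: contra uU => vU; apply: stay vU _; rewrite adjC.
  by apply: contraT => vS; have := noadjS u v uS vS; rewrite uv.
have iso (W : {set V}) : (forall u v, u \in W -> adj H u v -> v \in W) -> crossing H W == set0.
  move=> stW; apply/set0Pn=> -[e]; rewrite inE => /and3P[eH eW /pred0Pn[x /andP[xe xW]]].
  case/negP: eW; have [y [z [yz eE]]] := edge_ends gH eH.
  have yzH : adj H y z by rewrite /adj -eE.
  have zyH : adj H z y by rewrite adjC.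
  have {xe}: x \in e := xe; have {}xW : x \in W := xW.
  rewrite eE !inE subUset !sub1set => /orP[]/eqP E; rewrite E in xW.
    by rewrite xW (stW _ _ xW yzH).
  by rewrite xW (stW _ _ xW zyH).
have split_in : (#|inside H U| + #|inside H (S :\: U)| = #|inside H S|)%N.
  rewrite -cardsUI (_ : _ :&: _ = set0) ?cards0 ?addn0; last first.
    apply/setP=> e; rewrite !inE; apply/negbTE/negP=> /andP[/andP[eH eU] /andP[_ eSU]].
    have [y [z [yz eE]]] := edge_ends gH eH.
    move: eU eSU; rewrite eE !subUset !sub1set => /andP[yU _] /andP[].
    by rewrite inE yU.
  apply: eq_card => e; rewrite !inE -andb_orr.
  case eH: (e \in H) => //=; have [y [z [yz eE]]] := edge_ends gH eH.
  have yzH : adj H y z by rewrite /adj -eE.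
  have zyH : adj H z y by rewrite adjC.
  rewrite eE !subUset !sub1set; apply/idP/idP.
    case/orP=> /andP[]; first by move=> /(subsetP US)-> /(subsetP US)->.
    by rewrite !inE => /andP[_ ->] /andP[_ ->].
  case/andP=> yS zS; have [yU|yU] := boolP (y \in U); first by rewrite (stay _ _ yU yzH).
  have ySU : y \in S :\: U by rewrite inE yU.
  by rewrite ySU (staySU _ _ ySU yzH) orbT.
have cS : (#|U| + #|S :\: U| = #|S|)%N by rewrite -(cardsID U S) (setIidPr US).
have SU0 : S :\: U != set0.
  by rewrite setD_eq0; apply: contra US' => SU; rewrite eqEsubset US.
have [lt|ge] := ltnP #|inside H U| #|U|.
  by case/eqP: US'; apply: Smin' => //; apply/and3P; split=> //; apply: iso.
case/negP: U0; apply/eqP; have : S :\: U = S.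
  apply: Smin'; rewrite ?subsetDl //; apply/and3P; split=> //; first exact: iso.
  move: Sc; rewrite -split_in -cS; move: ge; lia.
by move/setDidPl; rewrite -setI_eq0 (setIidPr US) => /eqP.
Qed.

(** Crossing edges of a copy of [F] are counted in [F] itself. *)
Lemma crossing_preim (T V : finType) (F : {set {set T}}) (f : T -> V) (S : {set V})
    (e : {set T}) : e \in F ->
  (e \in crossing F (f @^-1: S)) = ~~ (f @: e \subset S) && ~~ [disjoint f @: e & S].
Proof.
move=> eF; rewrite inE eF /= sub_imset_pre; congr (_ && ~~ _).
rewrite -!setI_eq0; apply/idP/idP=> /eqP/setP E; apply/eqP/setP=> x; rewrite !inE.
  apply/negbTE/negP=> /andP[/imsetP[y ye ->] yS]; have := E y.
  by rewrite !inE ye yS.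
by apply/negbTE/negP=> /andP[xe xS]; have := E (f x); rewrite !inE imset_f // xS.
Qed.

(** All degrees being 2, the degree sum over any vertex set is even, so a copy of [F]
never has exactly one crossing edge.  Hence no edge leaving a union of components
of [H] can be activated first: [H] is connected. *)
Lemma wsat_ge_cycle (T V : finType) (F : {set {set T}}) :
  is_graph F -> F != set0 -> (forall t, degree F t = 2) ->
  (#|V| <= wsat F (complete_graph V) + 1)%N.
Proof.
move=> gF F0 deg2; have [H [HK Hact] <-] := wsat_attained (complete_graph V) F0.
have [->//|/card_gt0P[v _]] := posnP #|V|.
have conn (U : {set V}) : U \subset setT -> U != set0 -> U != setT ->
    exists u v, [/\ u \in U, v \in setT :\: U & adj H u v].
  move=> _ U0 UT.
  suff /existsP[u /existsP[w /and3P[uU wU uw]]] :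
    [exists u, exists v, [&& u \in U, v \in setT :\: U & adj H u v]] by exists u, w.
  apply: contraT => /existsPn none.
  have noadj x y : x \in U -> y \notin U -> ~~ adj H x y.
    by move=> xU yU; have /existsPn/(_ y) := none x; rewrite !inE xU yU.
  have stuck e : active F (complete_graph V) H e ->
      ~~ (~~ (e \subset U) && ~~ [disjoint e & U]).
    elim=> [{}e eH|{e} f e0 finj e0F _ _ IH].
      apply/negP=> /andP[eU /pred0Pn[x /andP[xe xU]]].
      have {}xe : x \in e := xe; have {}xU : x \in U := xU.
      case/negP: eU; have [y [z [yz eE]]] := edge_ends HK eH.
      have yzH : adj H y z by rewrite /adj -eE.
      have zyH : adj H z y by rewrite adjC.
      move: xe; rewrite eE !inE subUset !sub1set => /orP[]/eqP E; rewrite E in xU.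
        by rewrite xU; apply: contraLR yzH => zU; apply: noadj.
      by rewrite xU andbT; apply: contraLR zyH => yU; apply: noadj.
    rewrite -(crossing_preim f U e0F); apply/negP=> cr.
    have crE : crossing F (f @^-1: U) = [set e0].
      apply/setP=> e; rewrite in_set1; apply/idP/eqP=> [ecr|->//].
      apply: contraTeq (ecr) => ne; have eF : e \in F by move: ecr; rewrite inE => /andP[].
      rewrite crossing_preim //; apply: IH => //.
      by apply: contraNneq ne => /(imset_inj finj)->.
    have := handshake (f @^-1: U) gF; rewrite crE cards1.
    under eq_bigr do rewrite deg2.
    by rewrite sum_nat_const; lia.
  have /set0Pn[x xU] := U0.
  have /subsetPn[y _ yU] : ~~ (setT \subset U) by rewrite subTset.
  have xyK : adj (complete_graph V) x y.
    rewrite /adj inE cards2; have -> // : x != y by apply: contraNneq yU => <-.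
  have := crossing_adj xU yU xyK; rewrite inE => /andP[_ cr].
  by case/negP: (stuck _ (Hact _ xyK)).
have := inside_count conn (subsetT [set v]) _; rewrite -cards_eq0 cards1 => /(_ isT).
have : (#|inside H setT| <= #|H|)%N.
  by apply: subset_leq_card; apply/subsetP=> e; rewrite inE => /andP[].
have : (#|setT :\: [set v]| + 1 = #|V|)%N.
  by rewrite setTD cardsC1 addn1 prednK //; apply/card_gt0P; exists v.
lia.
Qed.

(** If [H] had fewer than [#|V| - 1] edges, it would have a sparse component [S], a
tree.  No edge touching [S] can be the first one to be activated: in the new copy
of [F], the vertices [W] placed in [S] would span fewer than [#|W|] edges besides
the new one, while the minimum degree 2 forces at least that many if the new edge
leaves [S], and if it lies inside [S] then connectedness of [F] makes [W]
everything, so [F] would have at most [#|T|] edges. *)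
Lemma wsat_ge_noncycle (T V : finType) (F : {set {set T}}) :
  is_graph F -> is_connected F -> (forall t, 2 <= degree F t)%N -> (#|T| < #|F|)%N ->
  (#|V| <= wsat F (complete_graph V) + 1)%N.
Proof.
move=> gF cF deg2 TF.
have F0 : F != set0 by rewrite -card_gt0; apply: leq_ltn_trans TF.
have [H [HK Hact] <-] := wsat_attained (complete_graph V) F0.
rewrite leqNgt addn1; apply/negP=> HV.
have [S [S0 Sx Ssparse Sconn]] := sparse_component HK (ltnW HV).
(* edges touching S never become active unless they are in H *)
have new e : active F (complete_graph V) H e -> e \in H \/ [disjoint e & S].
  elim=> [{}e eH|{e} f e0 finj e0F _ _ IH]; first by left.
  have [dis|meet] := boolP [disjoint f @: e0 & S]; first by right.
  exfalso; pose W := f @^-1: S.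
  have img e : e \in F -> e != e0 -> ~~ [disjoint f @: e & S] ->
      f @: e \in H /\ e \subset W.
    move=> eF ne meet'; have eH : f @: e \in H.
      have [|//|dis] := IH e eF; last by rewrite dis in meet'.
      by apply: contraNneq ne => /(imset_inj finj)->.
    split=> //; rewrite -sub_imset_pre; apply: contraT => nsub.
    have : f @: e \in crossing H S by rewrite inE eH nsub.
    by rewrite Sx inE.
  have nd e : e \in F -> e \subset W -> ~~ [disjoint f @: e & S].
    move=> eF; have [x [y [_ ->]]] := edge_ends gF eF.
    rewrite subUset !sub1set inE => /andP[fxS _].
    by apply/pred0Pn; exists (f x); rewrite /= imset_f // !inE eqxx.
  have W0 : W != set0.
    have /pred0Pn[_ /andP[/imsetP[x _ ->] fxS]] := meet.
    by apply/set0Pn; exists x; rewrite inE.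
  have fWS : f @: W \subset S by rewrite sub_imset_pre.
  have fW0 : f @: W != set0 by rewrite imset_eq0.
  have few : (#|inside F W :\ e0| < #|W|)%N.
    have cU := inside_count Sconn fWS fW0.
    have cS : (#|f @: W| + #|S :\: f @: W| = #|S|)%N.
      by rewrite -(cardsID (f @: W) S) (setIidPr fWS).
    have : (#|inside F W :\ e0| <= #|inside H (f @: W)|)%N.
      rewrite -(card_imset _ (imset_inj finj)); apply: subset_leq_card.
      apply/subsetP=> _ /imsetP[e + ->]; rewrite !inE => /and3P[ne eF eW].
      by have [-> _] := img e eF ne (nd e eF eW); rewrite imsetS.
    by move: cU cS Ssparse; rewrite (card_imset _ finj); clear; lia.
  have crE : crossing F W \subset [set e0].
    apply/subsetP=> e ecr; rewrite in_set1; apply: contraT => ne.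
    have eF : e \in F by move: ecr; rewrite inE => /andP[].
    move: ecr; rewrite crossing_preim // => /andP[nsub meet'].
    by have [_] := img e eF ne meet'; rewrite -sub_imset_pre (negPf nsub).
  have [e0W|e0W] := boolP (e0 \subset W).
    have closedW : closed (adj F) W.
      suff sub x y : adj F x y -> x \in W -> y \in W.
        by move=> x y xy; apply/idP/idP; apply: sub; rewrite // adjC.
      move=> xy xW; apply: contraT => yW; have cr := crossing_adj xW yW xy.
      have /set1P E := subsetP crE _ cr.
      by move: cr; rewrite inE E e0W andbF.
    have WT t : t \in W.
      by have /set0Pn[w wW] := W0; rewrite -(closed_connect closedW (cF w t)).
    have FW : inside F W = F.
      by apply/setP=> e; rewrite inE andb_idr // => _; apply/subsetP=> t _.
    have cW : (#|W| <= #|T|)%N by exact: max_card.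
    by move: few TF cW; rewrite FW (cardsD1 e0 F) e0F; clear; lia.
  have e0in : inside F W :\ e0 = inside F W.
    apply/setP=> e; rewrite in_setD1 andb_idl // inE => /andP[_ eW].
    by apply: contraNneq e0W => <-.
  have cr1 : (#|crossing F W| <= 1)%N by rewrite -(cards1 e0) subset_leq_card.
  have := handshake W gF.
  have : (2 * #|W| <= \sum_(v in W) degree F v)%N.
    by rewrite mulnC -sum_nat_const; apply: leq_sum => v _; exact: deg2.
  by move: few cr1; rewrite e0in; clear; lia.
(* so H contains all edges at a vertex of S, which is too many *)
have /set0Pn[v vS] := S0.
have degv : (degree H v <= #|H|)%N.
  by apply: subset_leq_card; apply/subsetP=> e; rewrite inE => /andP[].
suff : (#|[set~ v]| <= degree H v)%N by rewrite cardsC1; lia.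
rewrite degree_card_adj //; apply: subset_leq_card; apply/subsetP=> b; rewrite !inE => bv.
have vb : adj (complete_graph V) v b by rewrite /adj inE cards2 (eq_sym v) bv.
have [//|/pred0P/(_ v)] := new _ (Hact _ vb).
by rewrite /= !inE eqxx vS.
Qed.

(** * Complete and complete bipartite graphs *)

Section Hyperconnectivity.
Local Open Scope ring_scope.

Definition lagrange_weight (I : finType) (K : fieldType) (x : I -> K) (A : {set I}) (i : I) : K :=
  (\prod_(j in A :\ i) (x i - x j))^-1.

Lemma lagrange_weight_neq0 (I : finType) (K : fieldType) (x : I -> K) (A : {set I}) i :
  injective x -> lagrange_weight x A i != 0.
Proof.
move=> xinj; rewrite invr_eq0; apply/prodf_neq0 => j; rewrite !inE => /andP[ji _].
by rewrite subr_eq0 (inj_eq xinj) eq_sym.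
Qed.

(** Divided differences: the left-hand side is the coefficient of degree [#|A| - 1]
in the Lagrange interpolation of [g] at the points [x i], [i] in [A], and this
interpolation is [g] itself. *)
Lemma lagrange_sum (I : finType) (K : fieldType) (x : I -> K) (A : {set I}) (g : {poly K}) :
  injective x -> (size g < #|A|)%N ->
  \sum_(i in A) lagrange_weight x A i * g.[x i] = 0.
Proof.
move=> xinj gA; pose L i : {poly K} := \prod_(j in A :\ i) ('X - (x j)%:P).
have Lenum i : L i = \prod_(j <- enum (A :\ i)) ('X - (x j)%:P) by rewrite big_enum.
have sizeL i : i \in A -> size (L i) = #|A|.
  by move=> iA; rewrite Lenum size_prod_XsubC -cardE (cardsD1 i A) iA add1n.
pose P := \sum_(i in A) (lagrange_weight x A i * g.[x i]) *: L i.
have LE i k : i \in A -> k \in A ->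
    lagrange_weight x A i * (L i).[x k] = (i == k)%:R.
  move=> iA kA; rewrite horner_prod.
  have [->|ik] := eqVneq i k.
    under eq_bigr do rewrite !hornerE.
    by rewrite mulVf // -invr_eq0 lagrange_weight_neq0.
  by rewrite [X in _ * X](bigD1 k) /= ?hornerXsubC ?subrr ?mul0r ?mulr0 // !inE eq_sym ik.
have PE k : k \in A -> P.[x k] = g.[x k].
  move=> kA; rewrite horner_sum (bigD1 k) //= big1 => [|i /andP[iA ik]].
    by rewrite hornerZ mulrAC LE // eqxx mul1r addr0.
  by rewrite hornerZ mulrAC LE // (negPf ik) mul0r.
have Pg : P = g.
  apply/eqP; rewrite -subr_eq0; apply/eqP.
  apply: (@roots_geq_poly_eq0 _ _ [seq x i | i <- enum A]).
  - apply/allP=> y /mapP[k]; rewrite mem_enum => kA ->.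
    by rewrite /root !hornerE PE // subrr.
  - by rewrite map_inj_uniq ?enum_uniq.
  rewrite size_map -cardE; apply: leq_trans (size_polyD _ _) _.
  rewrite geq_max size_polyN (ltnW gA) andbT.
  apply: leq_trans (size_sum _ _ _) _; apply/bigmax_leqP=> i iA.
  by apply: leq_trans (size_scale_leq _ _) _; rewrite sizeL.
have : P`_(#|A|.-1) = 0.
  by rewrite Pg nth_default // -ltnS prednK //; apply: leq_ltn_trans gA.
apply: etrans; rewrite coef_sum; apply: eq_bigr => i iA.
rewrite coefZ -(sizeL i iA) -/(lead_coef (L i)).
by rewrite (monicP _) ?mulr1 // Lenum monic_prod_XsubC.
Qed.

(** With a polynomial [f v] of size at most [d] attached to each vertex, this linear
form in [f] represents the edge [u v] as a vector.  These vectors realise the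
d-dimensional hyperconnectivity matroid on the points of the moment curve.  The
form is antisymmetric, so its vanishing depends on the unordered edge only. *)
Definition stress (I : Type) (K : fieldType) (x : I -> K) (f : I -> {poly K}) (u v : I) : K :=
  (f v).[x u] - (f u).[x v].

Lemma stressC (I : Type) (K : fieldType) (x : I -> K) (f : I -> {poly K}) u v :
  stress x f u v = - stress x f v u.
Proof. by rewrite /stress opprB. Qed.

(** In the matroid, each edge of a copy of [F] is in the span of the other edges.
Dually: an assignment killed by all edges of the copy but one is killed by the
last one too. *)
Definition stress_dependent (T : finType) (F : {set {set T}}) (d : nat) : Prop :=
  forall (x : T -> rat) (f : T -> {poly rat}) u0 v0, injective x ->
    (forall t, (size (f t) <= d)%N) -> [set u0; v0] \in F ->
    (forall u v, [set u; v] \in F -> [set u; v] != [set u0; v0] -> stress x f u v = 0) ->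
    stress x f u0 v0 = 0.

Lemma set2_inj (V : finType) (a b c d : V) : [set a; b] = [set c; d] ->
  (a = c /\ b = d) \/ (a = d /\ b = c).
Proof.
move=> E.
have /set2P ha : a \in [set c; d] by rewrite -E !inE eqxx.
have /set2P hb : b \in [set c; d] by rewrite -E !inE eqxx orbT.
have /set2P hc : c \in [set a; b] by rewrite E !inE eqxx.
have /set2P hd : d \in [set a; b] by rewrite E !inE eqxx orbT.
by case: ha => ha; [left | right]; split=> //; case: hb hc hd => ? [] ? [] ?; congruence.
Qed.

(** The relation has coefficients [a u * b v], where [a] and [b] are the Lagrange
weights of the two sides; they never vanish, so any one edge can be isolated. *)
Lemma bipartite_stress_dependent (T : finType) (A : {set T}) d :
  (d < #|A|)%N -> (d < #|~: A|)%N ->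
  stress_dependent [set [set u; v] | u in A, v in ~: A] d.
Proof.
move=> dA dB x f u1 v1 xinj fd uvF zero.
suff main u0 v0 : u0 \in A -> v0 \in ~: A -> [set u0; v0] = [set u1; v1] -> stress x f u0 v0 = 0.
  case/imset2P: uvF => u0 v0 u0A v0A E.
  have E0 := main _ _ u0A v0A (esym E).
  by case: (set2_inj E) => -[-> ->] //; rewrite stressC E0 oppr0.
move=> u0A v0A E.
pose a := lagrange_weight x A; pose b := lagrange_weight x (~: A).
have S0 : \sum_(u in A) \sum_(v in ~: A) a u * b v * stress x f u v = 0.
  transitivity (\sum_(v in ~: A) b v * (\sum_(u in A) a u * (f v).[x u])
              - \sum_(u in A) a u * (\sum_(v in ~: A) b v * (f u).[x v])).
    rewrite [X in _ = X - _](eq_bigr (fun v => \sum_(u in A) a u * b v * (f v).[x u])); last first.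
      by move=> v _; rewrite mulr_sumr; apply: eq_bigr => u _; ring.
    rewrite [X in _ = X - _]exchange_big -sumrB /=; apply: eq_bigr => u _.
    by rewrite mulr_sumr -sumrB; apply: eq_bigr => v _; rewrite /stress; ring.
  rewrite !big1 ?subrr // => [u _|v _]; rewrite lagrange_sum ?mulr0 //.
    exact: leq_ltn_trans (fd _) dB.
  exact: leq_ltn_trans (fd _) dA.
have other u v : u \in A -> v \in ~: A -> (u, v) != (u0, v0) -> stress x f u v = 0.
  move=> uA vA ne; apply: zero; first exact: imset2_f.
  rewrite -E; apply: contraNneq ne => /set2_inj[[-> ->]//|[uE _]].
  by move: v0A; rewrite inE -uE uA.
move: S0; rewrite (bigD1 u0) //= [X in _ + X]big1; last first.
  move=> u /andP[uA uu0]; apply: big1 => v vA; rewrite other ?mulr0 //.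
  by rewrite xpair_eqE negb_and uu0.
rewrite addr0 (bigD1 v0) //= big1 => [|v /andP[vA vv0]]; last first.
  by rewrite other ?mulr0 // xpair_eqE negb_and vv0 orbT.
rewrite addr0 => /eqP; rewrite !mulf_eq0.
by rewrite !(negPf (lagrange_weight_neq0 _ _ xinj)) => /eqP.
Qed.

(** Here the coefficients are [c u * c v * (x u - x v)], with [c] the Lagrange weights
of all points.  The factor [x u - x v], without which the relation would not be
antisymmetric, raises the degree by one: hence at least [d + 2] points. *)
Lemma complete_stress_dependent (T : finType) d : (d.+1 < #|T|)%N ->
  stress_dependent (complete_graph T) d.
Proof.
move=> dT x f u0 v0 xinj fd uvF zero.
have u0v0 : u0 != v0 by move: uvF; rewrite inE cards2; case: (u0 != v0).
pose c := lagrange_weight x [set: T].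
have S0 : \sum_u \sum_v c u * c v * (x u - x v) * (f v).[x u] = 0.
  rewrite exchange_big /=; apply: big1 => v _.
  rewrite (eq_bigr (fun u => c v * (c u * (('X - (x v)%:P) * f v).[x u]))); last first.
    by move=> u _; rewrite hornerM hornerXsubC; ring.
  rewrite -mulr_sumr (eq_bigl (mem [set: T])) => [|u]; last by rewrite [RHS]in_setT.
  rewrite lagrange_sum ?mulr0 // cardsT; apply: leq_ltn_trans dT.
  by apply: leq_trans (size_polyMleq _ _) _; rewrite size_XsubC; apply: fd.
have S1 : \sum_u \sum_v c u * c v * (x u - x v) * stress x f u v = 0.
  transitivity ((\sum_u \sum_v c u * c v * (x u - x v) * (f v).[x u])
    + \sum_u \sum_v c v * c u * (x v - x u) * (f u).[x v]).
    rewrite -big_split; apply: eq_bigr => u _; rewrite -big_split; apply: eq_bigr => v _.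
    by rewrite /stress /=; ring.
  by rewrite [X in _ + X]exchange_big /= S0 addr0.
pose t u v := c u * c v * (x u - x v) * stress x f u v.
have t0 u v : [set u; v] != [set u0; v0] -> t u v = 0.
  move=> ne; rewrite /t; have [->|uv] := eqVneq u v; first by rewrite subrr mulr0 mul0r.
  by rewrite zero ?mulr0 // inE cards2 uv.
have row u : u != u0 -> u != v0 -> \sum_v t u v = 0.
  move=> uu0 uv0; apply: big1 => v _; apply: t0; apply: contraNneq uv0 => /setP/(_ u).
  by rewrite !inE eqxx (negPf uu0).
have row1 : \sum_v t u0 v = t u0 v0.
  rewrite (bigD1 v0) //= big1 ?addr0 // => v vv0; apply: t0.
  apply: contraNneq vv0 => /setP/(_ v0); rewrite !inE eqxx orbT eq_sym (negPf u0v0) /=.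
  by rewrite eq_sym.
have row2 : \sum_v t v0 v = t v0 u0.
  rewrite (bigD1 u0) //= big1 ?addr0 // => v vu0; apply: t0.
  apply: contraNneq vu0 => /setP/(_ u0); rewrite !inE eqxx (negPf u0v0) /=.
  by rewrite eq_sym.
pose rsum u := \sum_v t u v.
have : \sum_u rsum u = 0 by [].
rewrite (bigD1 u0) //= (bigD1 v0) 1?eq_sym //= big1 ?addr0 => [|u /andP[]]; last exact: row.
rewrite /rsum row1 row2 /t (stressC x f v0) => E.
have {}E : c u0 * c v0 * (x u0 - x v0) * stress x f u0 v0 *+ 2 = 0 by rewrite -E; ring.
move/eqP: E; rewrite mulrn_eq0 /= !mulf_eq0 !(negPf (lagrange_weight_neq0 _ _ xinj)) /=.
by rewrite subr_eq0 (inj_eq xinj) (negPf u0v0) => /eqP.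
Qed.

Lemma linear_kernel (K : fieldType) (n d m : nat) (phi : 'M[K]_(n, d) -> 'rV[K]_m) :
  linear phi -> (m < n * d)%N -> exists2 M, M != 0 & phi M = 0.
Proof.
move=> lin mnd.
pose L : {linear 'M[K]_(n, d) -> 'rV[K]_m} := HB.pack phi (GRing.isLinear.Build _ _ _ _ phi lin).
have : kermx (lin_mx L) != 0.
  rewrite -mxrank_eq0 mxrank_ker -lt0n subn_gt0.
  by apply: leq_ltn_trans (rank_leq_col _) _; rewrite mul1n.
case/rowV0Pn=> v /sub_kermxP v0 vn0; exists (vec_mx v); first by rewrite vec_mx_eq0.
by rewrite -[phi _]/(L _) -[LHS]mxvecK -mul_vec_lin vec_mxK v0 linear0.
Qed.

(** If [wsat] were smaller, dimension counting would give a nonzero assignment killed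
by the edges of [H] and vanishing at [d] fixed hub vertices.  Percolation then
forces it to be killed by every edge; the edges to the hubs give [d] roots of each
polynomial, which therefore vanishes. *)
Lemma stress_rank (T : finType) (F : {set {set T}}) d n :
  F != set0 -> stress_dependent F d ->
  (d * n <= wsat F (complete_graph 'I_n) + d * d)%N.
Proof.
move=> F0 dep; have [nd|dn] := leqP n d.
  by apply: leq_trans (leq_addl _ _); rewrite leq_mul2l nd orbT.
have [H [HK Hact] <-] := wsat_attained (complete_graph 'I_n) F0.
rewrite leqNgt; apply/negP=> HV.
pose x (v : 'I_n) : rat := (v : nat)%:R.
have xinj : injective x by move=> u v /eqP; rewrite eqr_nat => /eqP/val_inj.
pose f (M : 'M[rat]_(n, d)) (v : 'I_n) : {poly rat} := rVpoly (row v M).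
have fD (c : rat) M N v : f (c *: M + N) v = c *: f M v + f N v.
  by rewrite /f !linearP.
pose ends (e : {set 'I_n}) := [pick uv : 'I_n * 'I_n | e == [set uv.1; uv.2]].
pose value M e := if ends e is Some uv then stress x (f M) uv.1 uv.2 else 0.
pose hub (i : 'I_d) : 'I_n := widen_ord (ltnW dn) i.
pose phi (M : 'M[rat]_(n, d)) : 'rV[rat]_(#|H| + d * d) :=
  row_mx (\row_j value M (enum_val j)) (mxvec (\matrix_(i < d, j < d) M (hub i) j)).
have lin : linear phi.
  move=> c M N; rewrite /phi scale_row_mx add_row_mx -linearP /=; congr (row_mx _ (mxvec _)).
    apply/rowP=> j; rewrite !mxE /value; case: (ends _) => [[u v]|]; last by rewrite mulr0 addr0.
    by rewrite /stress !fD !hornerE /=; ring.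
  by apply/matrixP=> i j; rewrite !mxE.
have [|M Mn0 phiM] := linear_kernel lin; first by rewrite mulnC.
have [eqs hub0] := eq_row_mx (etrans phiM (esym (row_mx0 _ _ _ _))).
have fsize v : (size (f M v) <= d)%N by exact: size_poly.
have eqH u v : [set u; v] \in H -> stress x (f M) u v = 0.
  move=> uvH; have /rowP/(_ (enum_rank_in uvH [set u; v])) := eqs.
  rewrite !mxE enum_rankK_in // /value /ends; case: pickP => [[u' v'] /= /eqP E|/(_ (u, v))].
    by case: (set2_inj E) => -[-> ->] //; rewrite stressC => /eqP; rewrite oppr_eq0 => /eqP.
  by rewrite eqxx.
have eqK e : active F (complete_graph 'I_n) H e ->
    forall u v, e = [set u; v] -> stress x (f M) u v = 0.
  elim=> [{}e eH u v E|{e} g e0 ginj e0F _ _ IH u v E]; first by apply: eqH; rewrite -E.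
  have /imsetP[u' _ uE] : u \in g @: e0 by rewrite E !inE eqxx.
  have /imsetP[v' _ vE] : v \in g @: e0 by rewrite E !inE eqxx orbT.
  have gset a b : g @: [set a; b] = [set g a; g b] by rewrite imsetU1 imset_set1.
  have e0E : e0 = [set u'; v'] by apply: (imset_inj ginj); rewrite E gset uE vE.
  rewrite uE vE; apply: (dep (x \o g) (f M \o g)); rewrite -?e0E //.
  - exact: inj_comp.
  - by move=> t; exact: fsize.
  move=> a b abF ne; apply: (IH _ abF); last exact: gset.
  by apply: contraNneq ne => /(imset_inj ginj)->.
case/eqP: Mn0; apply/row_matrixP=> v; rewrite row0 -[row v M]rVpolyK -/(f M v).
suff -> : f M v = 0 by rewrite linear0.
have hubE i : f M (hub i) = 0.
  rewrite /f (_ : row _ _ = 0) ?linear0 //; apply/rowP=> j; rewrite !mxE.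
  have := congr1 vec_mx hub0; rewrite mxvecK linear0 => /matrixP/(_ i j).
  by rewrite !mxE.
apply: (@roots_geq_poly_eq0 _ _ [seq x (hub i) | i <- enum 'I_d]).
- apply/allP=> y /mapP[i _ ->].
  have [<-|iv] := eqVneq (hub i) v; first by rewrite hubE root0.
  have : [set hub i; v] \in complete_graph 'I_n by rewrite inE cards2 iv.
  move=> /Hact/eqK/(_ _ _ erefl); rewrite /stress hubE horner0 subr0 => /eqP //.
- rewrite map_inj_uniq ?enum_uniq // => i j /xinj E.
  by apply: val_inj; exact: (congr1 val E).
by rewrite size_map size_enum_ord.
Qed.

End Hyperconnectivity.

(** * Deterministic equality of the weak saturation numbers *)

Lemma min_degree_le (T : finType) (F : {set {set T}}) v : (min_degree F <= degree F v)%N.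
Proof.
rewrite /min_degree; have := mem_index_enum v.
elim: (index_enum T) => // u s IH; rewrite inE big_cons => /orP[/eqP->|/IH]; first exact: geq_minl.
by apply: leq_trans; exact: geq_minr.
Qed.

Lemma min_degree_attained (T : finType) (F : {set {set T}}) :
  is_graph F -> (0 < #|T|)%N -> exists v, degree F v = min_degree F.
Proof.
move=> gF /card_gt0P[v _].
have : min_degree F = #|T| \/ exists v, degree F v = min_degree F.
  rewrite /min_degree; elim/big_rec: _ => [|u m _ IH]; first by left.
  rewrite /minn; case: ltnP => _; first by right; exists u.
  exact: IH.
case=> // E; have := min_degree_le F v; rewrite E degree_card_adj // leqNgt => /negP[].
rewrite -cardsT; apply: proper_card; apply/properP; split; first exact: subsetT.
by exists v; rewrite inE // adjxx.
Qed.

Lemma min_degree_gt0_card (T : finType) (F : {set {set T}}) :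
  (0 < min_degree F)%N -> (0 < #|T|)%N.
Proof.
move=> deg1; apply: leq_trans deg1 _; rewrite /min_degree.
by elim/big_rec: _ => // u m _; apply: leq_trans; rewrite geq_minr.
Qed.

Lemma min_degree_gt0_neq0 (T : finType) (F : {set {set T}}) :
  (0 < min_degree F)%N -> F != set0.
Proof.
move=> deg1; have /card_gt0P[v _] := min_degree_gt0_card deg1.
have := leq_trans deg1 (min_degree_le F v).
apply: contraTneq => ->; rewrite /degree -leqNgt leqn0 cards_eq0.
by apply/eqP/setP=> e; rewrite !inE.
Qed.

(** Complete and complete bipartite graphs are covered by the rank argument,
minimum degree 1 is vacuous, and for connected graphs of minimum degree 2 the
bound is that of a connected graph, or of a graph without tree components. *)
Lemma wsat_linear_lower_bound (T : finType) (F : {set {set T}}) :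
  is_graph F -> (1 <= min_degree F)%N ->
  is_complete F \/ is_complete_bipartite F \/
    (is_connected F /\ (min_degree F = 1 \/ min_degree F = 2)) ->
  exists C, forall n, ((min_degree F).-1 * n <= wsat F (complete_graph 'I_n) + C)%N.
Proof.
move=> gF deg1 Fclass.
have T0 := min_degree_gt0_card deg1.
have F0 := min_degree_gt0_neq0 deg1.
set d := (min_degree F).-1.
have [stressF|{Fclass}] : stress_dependent F d \/
    is_connected F /\ (min_degree F = 1 \/ min_degree F = 2).
  have dE : d.+1 = min_degree F by rewrite prednK.
  case: Fclass => [FE|[[A [A0 B0 FE]]|]]; [left|left|by right].
    have /card_gt0P[v _] := T0; rewrite FE; apply: complete_stress_dependent.
    apply: leq_ltn_trans (_ : #|[set b | adj F v b]| < _)%N.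
      by rewrite dE -degree_card_adj // min_degree_le.
    rewrite -cardsT; apply: proper_card; apply/properP; split; first exact: subsetT.
    by exists v; rewrite inE // adjxx.
  rewrite FE; apply: bipartite_stress_dependent; rewrite dE.
    have /set0Pn[v vB] := B0; apply: leq_trans (min_degree_le F v) _.
    rewrite degree_card_adj //; apply: subset_leq_card; apply/subsetP=> u.
    rewrite inE /adj FE => /imset2P[a b aA bB /set2_inj[[E _]|[_ ->]]] //.
    by move: vB; rewrite E inE aA.
  have /set0Pn[v vA] := A0; apply: leq_trans (min_degree_le F v) _.
  rewrite degree_card_adj //; apply: subset_leq_card; apply/subsetP=> u.
  rewrite inE /adj FE => /imset2P[a b aA bB /set2_inj[[_ ->]|[E _]]] //.
  by move: bB; rewrite -E inE vA.
- by exists (d * d)%N => n; exact: stress_rank.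
case=> cF [E|E]; first by exists 0%N => n; rewrite /d E mul0n.
exists 1%N => n; rewrite /d E mul1n -[X in (X <= _)%N]card_ord.
have deg2 t : (2 <= degree F t)%N by rewrite -E min_degree_le.
have [/forallP deg2'|] := boolP [forall t, degree F t == 2].
  by apply: wsat_ge_cycle => // t; apply/eqP.
case/forallPn=> t tdeg; apply: wsat_ge_noncycle => //.
have := handshake [set: T] gF.
have -> : inside F setT = F by apply/setP=> e; rewrite inE subsetT andbT.
have -> : crossing F setT = set0 by apply/setP=> e; rewrite !inE subsetT andbF.
rewrite cards0 addn0 (bigD1 t) ?inE //= => sumE.
have : (2 * #|T| < \sum_(v in [set: T]) degree F v)%N.
  rewrite mulnC -sum1_card big_distrl /= (bigD1 t) //= [X in (_ < X)%N](bigD1 t) ?inE //=.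
  rewrite -addSn; apply: leq_add; first by have := deg2 t; move: tdeg; lia.
  rewrite [X in (_ <= X)%N](eq_bigl (fun v => v != t)) => [|v]; last by rewrite inE.
  by apply: leq_sum => v _; exact: deg2.
by rewrite (bigD1 t) ?inE //= sumE; lia.
Qed.

(** Choose [n0] minimising [wsat F K_n - (delta - 1) * n], a quantity that is bounded
below.  The construction started from a clique of size [n0] uses at most
[wsat F K_n] edges by minimality, whatever the value of [wsat F K_n] is, and an
extendable graph never does better than the complete graph. *)
Lemma wsat_extendable (T : finType) (F : {set {set T}}) :
  is_graph F -> (1 <= min_degree F)%N ->
  (exists C, forall n, ((min_degree F).-1 * n <= wsat F (complete_graph 'I_n) + C)%N) ->
  exists2 k, (0 < k)%N & forall n (G : {set {set 'I_n}}), (k <= n)%N -> is_graph G ->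
    extendable k G -> wsat F G = wsat F (complete_graph 'I_n).
Proof.
move=> gF deg1 [C lower]; set d := (min_degree F).-1 in lower.
have T0 := min_degree_gt0_card deg1.
have [a aE] := min_degree_attained gF T0.
have a0 : (0 < degree F a)%N by rewrite aE.
have F0 := min_degree_gt0_neq0 deg1.
(* the constant C keeps the subtraction from truncating *)
pose excess n := (wsat F (complete_graph 'I_n) + C - d * n)%N.
have exP : exists m, `[< exists2 n, (#|T| <= n)%N & excess n = m >].
  by exists (excess #|T|); apply/asboolP; exists #|T|.
have [_ /asboolP[n0 Tn0 <-] min_n0] := ex_minnP exP.
exists (n0 + #|T| + #|T| + 2)%N; first by rewrite addn2.
move=> n G kn gG ext.
apply/eqP; rewrite eqn_leq andbC; apply/andP; split.
  by apply: wsat_complete_le ext => //; rewrite leq_add2r leq_addl.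
apply: leq_trans (wsat_extendable_le gF a0 gG Tn0 (leqnn _) ext) _.
have : (excess n0 <= excess n)%N.
  by apply: min_n0; apply/asboolP; exists n => //; move: kn; clear; lia.
rewrite card_ord aE -/d mulnBr /excess.
have nn0 : (d * n0 <= d * n)%N by rewrite leq_mul2l; apply/orP; right; move: kn; clear; lia.
by have := lower n; have := lower n0; move: nn0; clear; lia.
Qed.

(** * Common neighbours in the random graph *)

Section Probability.
Local Open Scope ring_scope.

Section RandomGraph.
Variables (R : realType) (n : nat) (p : R).
Let K := complete_graph 'I_n.
Implicit Types (G B : {set {set 'I_n}}) (Q : pred {set {set 'I_n}}).

Lemma gnp_prob_expectation Q :
  gnp_prob p Q = \sum_(G : {set {set 'I_n}} | is_graph G) gnp_weight p G * (Q G)%:R.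
Proof.
rewrite /gnp_prob big_mkcondr; apply: eq_bigr => G _.
by case: (Q G); rewrite (mulr1, mulr0).
Qed.

Lemma gnp_prob_contains B : B \subset K ->
  gnp_prob p (fun G => B \subset G) = p ^+ #|B|.
Proof.
move=> /subsetP BK.
pose a (e : {set 'I_n}) : R := if e \in K then p else 0.
pose b (e : {set 'I_n}) : R := if e \in K then if e \in B then 0 else 1 - p else 1.
have <- : \prod_e (a e + b e) = p ^+ #|B|.
  rewrite -prodr_const [RHS]big_mkcond; apply: eq_bigr => e _; rewrite /a /b.
  case: (boolP (e \in B)) => [/BK->|_]; first by rewrite addr0.
  by case: (e \in K); rewrite ?add0r // addrC subrK.
rewrite bigA_distr /= [RHS](bigID (fun G => is_graph G && (B \subset G))) /=.
rewrite [X in _ + X]big1 ?addr0.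
  apply: eq_bigr => G /andP[/subsetP GK /subsetP BG].
  rewrite /gnp_weight big_mkcond; apply: eq_bigr => e _; rewrite /a /b -/K.
  case: (boolP (e \in G)) => [/GK->//|eG].
  by case: (boolP (e \in B)) => [/BG eG'|//]; rewrite eG' in eG.
move=> G; rewrite negb_and => /orP[] /subsetPn[e].
  by move=> eG eK; rewrite (bigD1 e) //= eG /a (negPf eK) mul0r.
by move=> eB eG; rewrite (bigD1 e) //= (negPf eG) /b BK // eB mul0r.
Qed.

Definition star (S : {set 'I_n}) (z : 'I_n) : {set {set 'I_n}} := [set [set z; s] | s in S].

(** The stars from [S] to different vertices [z] outside [S] are disjoint, so the
events that they are contained in the random graph are independent.  This is
verified by expanding the product of the indicators of the complementary events
and taking expectations term by term. *)
Lemma gnp_prob_no_common_neighbour (S : {set 'I_n}) :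
  gnp_prob p (fun G => [forall z in ~: S, ~~ (star S z \subset G)]) =
  (1 - p ^+ #|S|) ^+ #|~: S|.
Proof.
pose F (c : 'I_n -> R) z := if z \in S then 0 else - c z.
have expand (c : 'I_n -> R) :
    \prod_(z in ~: S) (1 - c z) = \sum_(Z : {set 'I_n}) \prod_(z in Z) F c z.
  rewrite [LHS]big_mkcond /=.
  under eq_bigr => z _.
    rewrite (_ : (if _ then _ else _) = F c z + 1); last first.
      by rewrite /F inE; case: (z \in S); rewrite ?add0r // addrC.
    over.
  by rewrite bigA_distr; apply: eq_bigr => Z _; rewrite [RHS]big_mkcond.
rewrite -prodr_const expand gnp_prob_expectation.
rewrite (eq_bigr (fun G => \sum_(Z : {set 'I_n})
    gnp_weight p G * \prod_(z in Z) F (fun z => (star S z \subset G)%:R) z)); last first.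
  move=> G _; rewrite -mulr_sumr -expand; congr (_ * _).
  case: forall_inP => [no|some].
    by rewrite big1 // => z /no/negPf->; rewrite subr0.
  have /forall_inPn[z zS] : ~~ [forall z in ~: S, ~~ (star S z \subset G)].
    by apply/negP=> /forall_inP.
  by rewrite negbK => st; rewrite (bigD1 z) //= st subrr mul0r.
rewrite exchange_big; apply: eq_bigr => Z _ /=.
have [/exists_inP[z zZ zS]|] := boolP [exists z in Z, z \in S].
  rewrite [RHS](bigD1 z) //= /F zS mul0r big1 // => G _.
  by rewrite (bigD1 z) //= zS mul0r mulr0.
rewrite negb_exists_in => /forall_inP ZS.
pose B := [set [set z; s] | z in Z, s in S].
have cardB : #|B| = (#|Z| * #|S|)%N.
  rewrite /B curry_imset2X card_in_imset ?cardsX // => -[z s] [z' s'].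
  rewrite !inE /= => /andP[zZ sS] /andP[zZ' sS'] /set2_inj[[-> ->]//|[zs _]].
  by have := ZS z zZ; rewrite zs sS'.
have BK : B \subset K.
  apply/subsetP=> _ /imset2P[z s zZ sS ->]; rewrite inE cards2.
  by have -> // : z != s; apply: contraNneq (ZS z zZ) => ->.
rewrite (eq_bigr (fun G => (-1) ^+ #|Z| * (gnp_weight p G * (B \subset G)%:R))); last first.
  move=> G _; rewrite mulrCA; congr (_ * _).
  rewrite (eq_bigr (fun z => -1 * (star S z \subset G)%:R)); last first.
    by move=> z /ZS/negPf zS; rewrite /F zS mulN1r.
  rewrite big_split /= prodr_const; congr (_ * _).
  case: (boolP (B \subset G)) => [/subsetP BG|/subsetPn[_ /imset2P[z s zZ sS ->] nG]].
    rewrite big1 // => z zZ; rewrite (_ : star S z \subset G) //.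
    by apply/subsetP=> _ /imsetP[s sS ->]; apply: BG; apply: imset2_f.
  rewrite (bigD1 z) //= (_ : star S z \subset G = false) ?mul0r //.
  by apply/negbTE/subsetPn; exists [set z; s] => //; apply: imset_f.
rewrite -mulr_sumr -gnp_prob_expectation gnp_prob_contains // cardB mulnC exprM.
rewrite (eq_bigr (fun z => -1 * p ^+ #|S|)).
  by rewrite big_split /= !prodr_const.
by move=> z /ZS/negPf zS; rewrite /F zS mulN1r.
Qed.

Hypothesis p01 : 0 <= p <= 1.

Lemma gnp_weight_ge0 G : 0 <= gnp_weight p G.
Proof.
have /andP[p0 p1] := p01.
by apply: prodr_ge0 => e _; case: ifP => _ //; rewrite subr_ge0.
Qed.

Lemma gnp_prob_le Q Q' : (forall G, is_graph G -> Q G -> Q' G) ->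
  gnp_prob p Q <= gnp_prob p Q'.
Proof.
move=> QQ'; rewrite !gnp_prob_expectation; apply: ler_sum => G gG.
apply: ler_wpM2l; first exact: gnp_weight_ge0.
by rewrite ler_nat; case: (boolP (Q G)) => // /(QQ' _ gG)->.
Qed.

Lemma gnp_probC Q : gnp_prob p Q = 1 - gnp_prob p (fun G => ~~ Q G).
Proof.
rewrite -(gnp_probT n p) !gnp_prob_expectation -sumrB; apply: eq_bigr => G _.
by rewrite -mulrBr; congr (_ * _); case: (Q G); rewrite ?subr0 ?subrr.
Qed.

(** Union bound over the sets of size exactly [k], to which smaller sets without a
common neighbour can be enlarged. *)
Lemma gnp_prob_not_extendable k : (k <= n)%N ->
  gnp_prob p (fun G => ~~ extendable k G) <= n%:R ^+ k * (1 - p ^+ k) ^+ (n - k).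
Proof.
move=> kn; pose bad (S : {set 'I_n}) G := [forall z in ~: S, ~~ (star S z \subset G)].
have badP G : is_graph G -> ~~ extendable k G -> exists2 S : {set 'I_n}, #|S| == k & bad S G.
  move=> gG /forallPn[S]; rewrite negb_imply => /andP[Sk none].
  have [|B /subsetP BS Bk] := @exists_subset_card _ (~: S) (k - #|S|).
    by rewrite [#|~: S|]cardsCs setCK card_ord leq_sub2r.
  exists (S :|: B).
    rewrite cardsU (_ : S :&: B = set0) ?cards0 ?subn0 ?Bk ?subnKC //.
    apply/setP=> x; rewrite !inE; apply/negbTE/negP=> /andP[xS /BS].
    by rewrite inE xS.
  apply/forall_inP=> z _; apply: contra none => /subsetP zG.
  apply/existsP; exists z; apply/forall_inP=> s sS.
  by apply: zG; apply: imset_f; rewrite inE sS.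
apply: le_trans (_ : \sum_(S : {set 'I_n} | #|S| == k) gnp_prob p (bad S) <= _).
  under [leRHS]eq_bigr do rewrite gnp_prob_expectation.
  rewrite exchange_big gnp_prob_expectation; apply: ler_sum => G gG /=.
  rewrite -mulr_sumr; apply: ler_wpM2l; first exact: gnp_weight_ge0.
  case: (boolP (extendable k G)) => [_|/(badP _ gG)[S Sk SG]]; first exact: sumr_ge0.
  by rewrite (bigD1 S) //= SG lerDl sumr_ge0.
rewrite (eq_bigr (fun=> (1 - p ^+ k) ^+ (n - k))); last first.
  move=> S /eqP Sk; rewrite gnp_prob_no_common_neighbour Sk.
  by rewrite [#|~: S|]cardsCs setCK card_ord Sk.
have /andP[p0 p1] := p01.
rewrite sumr_const -[_ *+ _]mulr_natl; apply: ler_wpM2r.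
  by rewrite exprn_ge0 // subr_ge0 exprn_ile1.
rewrite -natrX ler_nat -[X in (X <= _)%N]/(#|[pred S : {set 'I_n} | #|S| == k]|).
have -> : #|[pred S : {set 'I_n} | #|S| == k]| = 'C(n, k).
  by rewrite -[n in RHS]card_ord -(card_draws 'I_n k); apply: eq_card => S; rewrite !inE.
apply: leq_trans (leq_pmulr _ (fact_gt0 k)) _; rewrite bin_ffact.
elim: k {kn bad badP} => // k IH; rewrite ffactnSr expnSr.
by apply: leq_mul IH _; exact: leq_subr.
Qed.
End RandomGraph.

End Probability.

(** * Asymptotics *)

Local Open Scope classical_set_scope.
Local Open Scope ring_scope.

(** Compare [1 - q <= exp (- q)] with one term of the exponential series. *)
Lemma expr_1B_le (R : realType) (q : R) N m :
  0 < q <= 1 -> (0 < N)%N -> (1 - q) ^+ N <= m.+1`!%:R / (q * N%:R) ^+ m.+1.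
Proof.
move=> /andP[q0 q1] N0; set y := q * N%:R.
have y0 : 0 < y by rewrite mulr_gt0 // ltr0n.
apply: (@le_trans _ _ (expR (- y))).
  rewrite -mulNr expRM_natr; apply: lerXn2r; rewrite ?nnegrE ?subr_ge0 ?expR_ge0 //.
  exact: expR_ge1Dx.
have fact0 : 0 < m.+1`!%:R :> R by rewrite ltr0n fact_gt0.
rewrite expRN -invf_div lef_pV2 ?posrE ?expR_gt0 ?divr_gt0 ?exprn_gt0 //.
by apply: le_trans (expR_ge1Dxn m (ltW y0)); rewrite lerDr ler01.
Qed.

(** As [q * (n - k)] is at least of order [n ^ (1/2)], the exponential tail beats
[n ^ k] once the exponent [2 * (k + 1)] is used in it. *)
Lemma union_bound_le (R : realType) (k n : nat) (q : R) :
  (0 < n)%N -> (k.*2 <= n)%N -> q <= 1 -> n%:R `^ (- 2^-1) <= q ->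
  n%:R ^+ k * (1 - q) ^+ (n - k) <= (k.+1.*2)`!%:R * 4 ^+ k.+1 / n%:R.
Proof.
move=> n0 kn q1 qn; set s : R := Num.sqrt n%:R.
have nR : 0 < n%:R :> R by rewrite ltr0n.
have s0 : 0 < s by rewrite sqrtr_gt0.
have s2 : s ^+ 2 = n%:R by rewrite sqr_sqrtr // ltW.
have sq : s^-1 <= q by move: qn; rewrite powRN powR12_sqrt // ltW.
have q0 : 0 < q by apply: lt_le_trans sq; rewrite invr_gt0.
have N0 : (0 < n - k)%N by lia.
have := expr_1B_le (k.*2).+1 (introT andP (conj q0 q1)) N0.
rewrite -doubleS; set m := k.+1.*2 => tail.
have half : s / 2 <= q * (n - k)%:R.
  apply: (@le_trans _ _ (s^-1 * (n%:R / 2))).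
    by rewrite mulrA -s2 expr2 mulKf ?gt_eqF.
  apply: ler_pM; rewrite ?invr_ge0 ?divr_ge0 ?(ltW s0) ?(ltW nR) //.
  rewrite ler_pdivrMr // -natrM ler_nat; lia.
apply: (@le_trans _ _ (n%:R ^+ k * (m`!%:R / (s / 2) ^+ m))).
  apply: ler_wpM2l; first by rewrite exprn_ge0 // ltW.
  apply: le_trans tail _; apply: ler_wpM2l; first by [].
  rewrite lef_pV2 ?posrE ?exprn_gt0 ?mulr_gt0 ?invr_gt0 ?ltr0n //.
  by apply: lerXn2r => //; rewrite nnegrE; nra.
rewrite le_eqVlt; apply/orP; left; apply/eqP.
rewrite /m -mul2n exprM expr_div_n s2 expr_div_n exprS.
have -> : 2 ^+ 2 = 4 :> R by ring.
have nk : n%:R ^+ k != 0 :> R by rewrite expf_neq0 // gt_eqF.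
have k4 : 4 ^+ k.+1 != 0 :> R by rewrite expf_neq0.
by field; rewrite nk k4 gt_eqF.
Qed.

(** With [eps = 1 / (2 * k)] the probability [p ^ k] that a given vertex is joined to
[k] given ones is at least [n ^ (- 1/2)]. *)
Lemma gnp_extendable_cvg (R : realType) (k : nat) (p : nat -> R) : (0 < k)%N ->
  (forall n, 0 <= p n <= 1) ->
  (\forall n \near \oo, n%:R `^ (- (2 * k%:R)^-1) * ln n%:R <= p n) ->
  (fun n => gnp_prob (p n) (fun G : {set {set 'I_n}} => extendable k G)) @ \oo --> (1 : R).
Proof.
move=> k0 p01 plarge; pose C : R := 2 * ((k.+1.*2)`!%:R * 4 ^+ k.+1).
apply: (@squeeze_cvgr _ _ _ _ (fun n => 1 - C * harmonic n) (cst 1)).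
- near=> n.
  have kn : (k.*2 <= n)%N by near: n; exact: nbhs_infty_ge.
  have n0 : (0 < n)%N by near: n; exact: nbhs_infty_ge.
  have nR : 0 < n%:R :> R by rewrite ltr0n.
  have ln1 : 1 <= ln (n%:R : R).
    rewrite -[leLHS](@expRK R) ler_ln ?posrE ?expR_gt0 //.
    by near: n; exact: nbhs_infty_ger.
  have pn : n%:R `^ (- (2 * k%:R)^-1) <= p n.
    apply: le_trans (_ : n%:R `^ (- (2 * k%:R)^-1) * ln n%:R <= _); last by near: n.
    by rewrite ler_peMr // powR_ge0.
  have /andP[p0 p1] := p01 n.
  have qn : n%:R `^ (- 2^-1) <= p n ^+ k.
    apply: le_trans (_ : (n%:R `^ (- (2 * k%:R)^-1)) ^+ k <= _); last first.
      by apply: lerXn2r; rewrite ?nnegrE ?powR_ge0.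
    rewrite -powR_mulrn ?powR_ge0 // -powRrM invfM mulNr -mulrA mulVf ?mulr1 //.
    by rewrite pnatr_eq0 -lt0n.
  have q1 : p n ^+ k <= 1 by apply: exprn_ile1.
  have := union_bound_le n0 kn q1 qn.
  have := @gnp_prob_not_extendable R n (p n) (p01 n) k (leq_trans _ kn).
  rewrite -addnn leq_addr => /(_ isT) bad small.
  rewrite gnp_probC; apply/andP; split; last first.
    by rewrite gerBl; apply: sumr_ge0 => G _; exact: gnp_weight_ge0.
  rewrite lerD2l lerN2; apply: le_trans bad _; apply: le_trans small _.
  rewrite /C /harmonic /= [2 * _]mulrC -[_ * 2 / _]mulrA; apply: ler_wpM2l.
    by rewrite mulr_ge0 // exprn_ge0.
  rewrite -[X in X <= _]mul1r ler_pdivrMr // mulrAC ler_pdivlMr ?ltr0n // mul1r.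
  by rewrite -natrM ler_nat; lia.
- rewrite -[X in _ --> X]subr0 -(mulr0 C); apply: cvgB; first exact: cvg_cst.
  by apply: cvgMr; exact: cvg_harmonic.
- exact: cvg_cst.
Unshelve. all: by end_near.
Qed.

Theorem mainTheorem3 (R : realType) (T : finType) (F : {set {set T}})
  (F_graph : is_graph F)
  (F_min_degree : (1 <= min_degree F)%N)
  (F_class : is_complete F \/ is_complete_bipartite F \/
    (is_connected F /\ (min_degree F = 1%N \/ min_degree F = 2%N))) :
  exists eps : R, 0 < eps /\
    forall p : nat -> R,
      (forall n, 0 <= p n <= 1) ->
      (\forall n \near \oo, n%:R `^ (- eps) * ln n%:R <= p n) ->
      (fun n : nat =>
         gnp_prob (p n) (fun G : {set {set 'I_n}} =>
           wsat F G == wsat F (complete_graph 'I_n))) @ \oo --> (1 : R).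
Proof.
have lower := wsat_linear_lower_bound F_graph F_min_degree F_class.
have [k k0 wsatE] := wsat_extendable F_graph F_min_degree lower.
exists (2 * k%:R)^-1; split; first by rewrite invr_gt0 mulr_gt0 // ltr0n.
move=> p p01 plarge.
apply: (@squeeze_cvgr _ _ _ _
  (fun n => gnp_prob (p n) (fun G : {set {set 'I_n}} => extendable k G)) (cst 1)).
- near=> n; have kn : (k <= n)%N by near: n; exact: nbhs_infty_ge.
  apply/andP; split.
    by apply: gnp_prob_le => // G gG ext; apply/eqP; exact: wsatE.
  rewrite -(gnp_probT n (p n)).
  exact: gnp_prob_le.
- exact: gnp_extendable_cvg.
- exact: cvg_cst.
Unshelve. all: by end_near.
Qed.
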